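(* Assume (A1) and (A2). Let $(\boldsymbol\pi,\boldsymbol\mu)$ be a GMFE such that for all $t,x,u$ the map $\alpha\mapsto\pi^\alpha_t(u\mid x)$ is Lipschitz on $\mathcal I$ except at finitely many points. Then for any $\varepsilon,p>0$ there exists $N'$ such that for all $N>N'$ the policy tuple $(\pi^1,\dots,\pi^N)=\Gamma_N(\boldsymbol\pi)\in\Pi^N$ is an $(\varepsilon,p)$-Markov–Nash equilibrium of the $N$-agent game.
   Context: Setting: finite $\mathcal X,\mathcal U$; $\mathcal T=\{0,\dots,T-1\}$; $\mathcal I=[0,1]$; $\mathcal P(\cdot)$, $\mathcal B(\cdot)$ probability resp. bounded nonnegative measures (vectors with $\ell_1$ norm); kernel $P:\mathcal X\times\mathcal U\times\mathcal B(\mathcal X)\to\mathcal P(\mathcal X)$, reward $r:\mathcal X\times\mathcal U\times\mathcal B(\mathcal X)\to\mathbb R$, initial law $\mu_0$; graphon $W:[0,1]^2\to[0,\infty)$ symmetric measurable integrable. Policies $\Pi=\mathcal P(\mathcal U)^{\mathcal T\times\mathcal X}$; policy ensembles $\boldsymbol\Pi$, mean field ensembles $\boldsymbol{\mathcal M}$: families indexed by $\alpha\in\mathcal I$, measurable in $\alpha$. $\mathbb G^\alpha(\boldsymbol\mu_t)=\int W(\alpha,\beta)\mu^\beta_td\beta$; $\Psi(\boldsymbol\pi)$: $\mu^\alpha_0=\mu_0$, $\mu^\alpha_{t+1}(x)=\sum_{x'}\mu^\alpha_t(x')\sum_u\pi^\alpha_t(u\mid x')P(x\mid x',u,\mathbb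 G^\alpha(\boldsymbol\mu_t))$. $J^{\boldsymbol\mu}_\alpha(\pi)=\mathbb E[\sum_{t<T}r(X_t,U_t,\mathbb G^\alpha(\boldsymbol\mu_t))]$ with $X_0\sim\mu_0$, $U_t\sim\pi_t(\cdot\mid X_t)$, $X_{t+1}\sim P(\cdot\mid X_t,U_t,\mathbb G^\alpha(\boldsymbol\mu_t))$. GMFE: $(\boldsymbol\pi,\boldsymbol\mu)$ with $\boldsymbol\mu=\Psi(\boldsymbol\pi)$ and $\pi^\alpha\in\arg\max_\pi J^{\boldsymbol\mu}_\alpha(\pi)$ for all $\alpha$. Finite game: graphs $G_N=(V_N,E_N)$, $V_N=\{1,\dots,N\}$, $\rho_N>0$, $\rho_N=\Theta(|E_N|/N^2)$, step graphon $W_N(x,y)=\mathbf 1\{\{\lceil Nx\rceil,\lceil Ny\rceil\}\in E_N\}$; under $(\pi^1,\dots,\pi^N)$: $X^i_0\sim\mu_0$ i.i.d., $U^i_t\sim\pi^i_t(\cdot\mid X^i_t)$, $X^i_{t+1}\sim P(\cdot\mid X^i_t,U^i_t,\mathbb G^i_t)$ conditionally independent, $\mathbb G^i_t=\frac1{N\rho_N}\sum_j\mathbf 1_{\{ij\in E_N\}}\delta_{X^j_t}$; $J^N_i(\pi^1,\dots,\pi^N)=\mathbb E[\sum_{t<T}r(X^i_t,U^i_t,\mathbb G^i_t)]$. $\Gamma_N(\boldsymbol\pi)=(\pi^{1/N},\dots,\pi^{N/N})$. An $(\varepsilon,p)$-Markov–Nash equilibrium is $(\pi^1,\dots,\pi^N)$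 such that for some $\mathcal W_N\subseteq V_N$ with $|\mathcal W_N|\ge\lfloor(1-p)N\rfloor$ and all $i\in\mathcal W_N$: $J^N_i(\pi^1,\dots,\pi^N)\ge\sup_{\pi\in\Pi}J^N_i(\pi^1,\dots,\pi^{i-1},\pi,\pi^{i+1},\dots,\pi^N)-\varepsilon$. (A1): $\|\rho_N^{-1}W_N-W\|_\square\to0$ and $\|\rho_N^{-1}W_N-W\|_{L_\infty\to L_1}\to0$ (cut norm $\sup_{S,T}|\int_{S\times T}U|$; $\|U\|_{L_\infty\to L_1}=\sup_{\|g\|_\infty\le1}\int|\int U(\alpha,\beta)g(\beta)d\beta|d\alpha$). (A2): $r,P$ are Lipschitz, and either $W$ is Lipschitz, or there are $L_W>0$ and disjoint intervals $\mathcal I_1,\dots,\mathcal I_Q$ covering $\mathcal I$ with $|W(x,y)-W(\tilde x,\tilde y)|\le L_W(|x-\tilde x|+|y-\tilde y|)$ for all $(x,y),(\tilde x,\tilde y)\in\mathcal I_i\times\mathcal I_j$, all $i,j$. *)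

(* Defs.v *)
From HB Require Import structures.
From mathcomp Require Import all_boot all_order all_algebra.
From mathcomp Require Import all_classical all_reals all_analysis.

Set Implicit Arguments.
Unset Strict Implicit.
Unset Printing Implicit Defensive.

Import Order.TTheory GRing.Theory Num.Theory.
Import numFieldNormedType.Exports.
Local Open Scope classical_set_scope.
Local Open Scope ring_scope.

Section GraphonMFG.
Variables (R : realType) (X U : finType).

Definition unitI : set R := `[0%R, 1%R].

Definition l1 (T : finType) (v : T -> R) : R := \sum_(x : T) `|v x|.
Definition is_prob (T : finType) (v : T -> R) : Prop :=
  (forall x, 0 <= v x) /\ \sum_(x : T) v x = 1.
(** B(X): bounded nonnegative measures on the finite set X *)
Definition is_bmeas (v : X -> R) : Prop := forall x, 0 <= v x.

(** kernel P(x' | x, u, nu) written  P x u nu x' ; reward r x u nu *)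
Definition kernel_ok (P : X -> U -> (X -> R) -> X -> R) : Prop :=
  forall x u nu, is_bmeas nu -> is_prob (P x u nu).

Definition is_policy (T : nat) (pi : nat -> X -> U -> R) : Prop :=
  forall t x, (t < T)%N -> is_prob (pi t x).

Definition is_pol_ensemble (T : nat) (pi : R -> nat -> X -> U -> R) : Prop :=
  (forall a, unitI a -> is_policy T (pi a)) /\
  (forall t x u, measurable_fun unitI (fun a => pi a t x u)).

Definition is_mf_ensemble (T : nat) (mu : R -> nat -> X -> R) : Prop :=
  (forall a t, unitI a -> (t < T)%N -> is_prob (mu a t)) /\
  (forall t x, measurable_fun unitI (fun a => mu a t x)).

Definition Gop (W : R -> R -> R) (mu : R -> nat -> X -> R) (a : R) (t : nat)
  : X -> R :=
  fun x => Rintegral (@lebesgue_measure R) unitI (fun b => W a b * mu b t x).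

Fixpoint psi_rec (W : R -> R -> R) (P : X -> U -> (X -> R) -> X -> R)
  (mu0 : X -> R) (pi : R -> nat -> X -> U -> R) (t : nat) : R -> X -> R :=
  match t with
  | 0 => fun _ => mu0
  | t'.+1 =>
      let m := psi_rec W P mu0 pi t' in
      fun a x =>
        \sum_(x' : X) m a x' *
          \sum_(u : U) pi a t' x' u *
            P x' u (fun y => Rintegral (@lebesgue_measure R) unitI
                                (fun b => W a b * m b y)) x
  end.

Definition Psi W P mu0 pi : R -> nat -> X -> R :=
  fun a t => psi_rec W P mu0 pi t a.

(** law of the state X_t of a single agent following pi in the MDP with
    time-varying kernel P(. | x, u, g t) *)
Fixpoint sa_law (P : X -> U -> (X -> R) -> X -> R) (mu0 : X -> R)
  (g : nat -> X -> R) (pi : nat -> X -> U -> R) (t : nat) : X -> R :=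
  match t with
  | 0 => mu0
  | t'.+1 => fun x =>
      \sum_(x' : X) sa_law P mu0 g pi t' x' *
        \sum_(u : U) pi t' x' u * P x' u (g t') x
  end.

Definition Jmf (T : nat) (W : R -> R -> R) (P : X -> U -> (X -> R) -> X -> R)
  (r : X -> U -> (X -> R) -> R) (mu0 : X -> R) (mu : R -> nat -> X -> R)
  (a : R) (pi : nat -> X -> U -> R) : R :=
  let g := Gop W mu a in
  \sum_(t < T) \sum_(x : X) sa_law P mu0 g pi t x *
     \sum_(u : U) pi t x u * r x u (g t).

Definition is_GMFE (T : nat) W P r mu0 (pi : R -> nat -> X -> U -> R)
  (mu : R -> nat -> X -> R) : Prop :=
  [/\ is_pol_ensemble T pi, is_mf_ensemble T mu,
      (forall a t x, unitI a -> (t < T)%N -> mu a t x = Psi W P mu0 pi a t x)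
    & (forall a, unitI a -> forall pi', is_policy T pi' ->
         Jmf T W P r mu0 mu a pi' <= Jmf T W P r mu0 mu a (pi a))].

Section Finite.
Variables (N : nat) (E : 'I_N -> 'I_N -> bool) (rho : R).

Definition Gfin (s : {ffun 'I_N -> X}) (i : 'I_N) : X -> R :=
  fun x => (N%:R * rho)^-1 * (#|[set j : 'I_N | E i j && (s j == x)]|)%:R.

Definition joint_pol (pis : 'I_N -> nat -> X -> U -> R) (t : nat)
  (s : {ffun 'I_N -> X}) (a : {ffun 'I_N -> U}) : R :=
  \prod_(j : 'I_N) pis j t (s j) (a j).

Fixpoint fin_law (P : X -> U -> (X -> R) -> X -> R) (mu0 : X -> R)
  (pis : 'I_N -> nat -> X -> U -> R) (t : nat) : {ffun 'I_N -> X} -> R :=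
  match t with
  | 0 => fun s => \prod_(j : 'I_N) mu0 (s j)
  | t'.+1 => fun s' =>
      \sum_(s : {ffun 'I_N -> X}) fin_law P mu0 pis t' s *
        \sum_(a : {ffun 'I_N -> U}) joint_pol pis t' s a *
          \prod_(j : 'I_N) P (s j) (a j) (Gfin s j) (s' j)
  end.

Definition JN (T : nat) P (r : X -> U -> (X -> R) -> R) mu0
  (pis : 'I_N -> nat -> X -> U -> R) (i : 'I_N) : R :=
  \sum_(t < T) \sum_(s : {ffun 'I_N -> X}) fin_law P mu0 pis t s *
    \sum_(a : {ffun 'I_N -> U}) joint_pol pis t s a * r (s i) (a i) (Gfin s i).

Definition deviate (pis : 'I_N -> nat -> X -> U -> R) (i : 'I_N)
  (pi' : nat -> X -> U -> R) : 'I_N -> nat -> X -> U -> R :=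
  fun j => if j == i then pi' else pis j.

(** (eps, p)-Markov-Nash equilibrium; the condition
    J_i >= sup_pi J_i(deviation) - eps is written for every pi in Pi *)
Definition is_MNE (T : nat) P r mu0 (eps p : R)
  (pis : 'I_N -> nat -> X -> U -> R) : Prop :=
  exists WN : {set 'I_N},
    (Num.floor ((1 - p) * N%:R) <= (#|WN|)%:Z)%R /\
    forall i, i \in WN -> forall pi', is_policy T pi' ->
      JN T P r mu0 (deviate pis i pi') i - eps <= JN T P r mu0 pis i.

End Finite.

(** Gamma_N(pi) = (pi^{1/N}, ..., pi^{N/N}); vertex i : 'I_N is agent i+1 *)
Definition GammaN (N : nat) (pi : R -> nat -> X -> U -> R)
  : 'I_N -> nat -> X -> U -> R :=
  fun i => pi (i.+1%:R / N%:R).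

End GraphonMFG.

Arguments unitI {R}.
Arguments GammaN {R X U} N pi.

Section Graphons.
Variable (R : realType).
Local Open Scope ereal_scope.

Definition leb := (@lebesgue_measure R).

(** x in ((i)/N, (i+1)/N], i.e. ceil(N x) = i+1 *)
Definition in_cell (N : nat) (i : 'I_N) (x : R) : bool :=
  ((i%:R / N%:R < x) && (x <= i.+1%:R / N%:R))%R.

Definition step_graphon (N : nat) (E : 'I_N -> 'I_N -> bool) (x y : R) : R :=
  if [exists i : 'I_N, exists j : 'I_N, [&& in_cell i x, in_cell j y & E i j]]
  then 1%R else 0%R.

Definition cut_norm (Uf : R -> R -> R) : \bar R :=
  ereal_sup [set e | exists S T : set R,
    [/\ measurable S, S `<=` unitI, measurable T, T `<=` unitI &
        e = `| \int[leb \x leb]_(z in S `*` T) (Uf z.1 z.2)%:E |]].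

Definition linf_l1_norm (Uf : R -> R -> R) : \bar R :=
  ereal_sup [set e | exists g : R -> R,
    [/\ measurable_fun unitI g, (forall b, unitI b -> (`|g b| <= 1)%R) &
        e = \int[leb]_(a in unitI)
               `| \int[leb]_(b in unitI) (Uf a b * g b)%:E |]].

Definition nedges (N : nat) (E : 'I_N -> 'I_N -> bool) : nat :=
  #|[set p : 'I_N * 'I_N | E p.1 p.2 && (p.1 <= p.2)%N]|.

Definition is_graphon (W : R -> R -> R) : Prop :=
  [/\ (forall x y, unitI x -> unitI y -> (0 <= W x y)%R),
      (forall x y, unitI x -> unitI y -> W x y = W y x),
      measurable_fun (unitI `*` unitI) (fun z : R * R => W z.1 z.2)
    & (leb \x leb).-integrable (unitI `*` unitI) (fun z => (W z.1 z.2)%:E)].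

(** piecewise Lipschitz: Lipschitz on each piece of [0,1] minus finitely
    many points *)
Definition lipschitz_except_finite (f : R -> R) : Prop :=
  exists (D : seq R) (L : R), forall a b, unitI a -> unitI b ->
    (forall d, d \in D -> ~ (Num.min a b <= d <= Num.max a b)%R) ->
    (`|f a - f b| <= L * `|a - b|)%R.

End Graphons.

Section Assumptions.
Variables (R : realType) (X U : finType).

Definition assumption_A1 (W : R -> R -> R) (E : forall N, 'I_N -> 'I_N -> bool)
  (rho : nat -> R) : Prop :=
  ((fun N => cut_norm (fun x y => (rho N)^-1 * step_graphon (E N) x y - W x y))
      @ \oo --> 0%E) /\
  ((fun N => linf_l1_norm (fun x y => (rho N)^-1 * step_graphon (E N) x y - W x y))
      @ \oo --> 0%E).

Definition discr (T : eqType) (a b : T) : R := if a == b then 0 else 1.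

Definition assumption_A2 (W : R -> R -> R) (P : X -> U -> (X -> R) -> X -> R)
  (r : X -> U -> (X -> R) -> R) : Prop :=
  [/\ (exists L : R, forall x x' u u' nu nu', is_bmeas nu -> is_bmeas nu' ->
         `|r x u nu - r x' u' nu'| <=
           L * (discr x x' + discr u u' + l1 (fun y => nu y - nu' y))),
      (exists L : R, forall x x' u u' nu nu', is_bmeas nu -> is_bmeas nu' ->
         l1 (fun y => P x u nu y - P x' u' nu' y) <=
           L * (discr x x' + discr u u' + l1 (fun y => nu y - nu' y)))
    & ((exists L : R, forall x y x' y', unitI x -> unitI y -> unitI x' ->
           unitI y' -> `|W x y - W x' y'| <= L * (`|x - x'| + `|y - y'|))
       \/
       (exists (LW : R) (Q : nat) (Iq : 'I_Q -> interval R),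
          [/\ 0 < LW,
              (forall i j z, z \in Iq i -> z \in Iq j -> i = j),
              (forall z, unitI z -> exists i, z \in Iq i)
            & (forall i j x y x' y', unitI x -> unitI y -> unitI x' -> unitI y' ->
                 x \in Iq i -> x' \in Iq i -> y \in Iq j -> y' \in Iq j ->
                 `|W x y - W x' y'| <= LW * (`|x - x'| + `|y - y'|))]))].

End Assumptions.

(* Main.v *)
(** A GMFE policy is unilaterally optimal in the limiting decision problem, so
    it suffices that, for all but [p N] agents [i] and uniformly over the
    deviations of [i], the payoff of [i] in the finite game is close to its
    mean field payoff, i.e. that the neighbourhood measure of [i] is close in L1
    to the mean field one at every time.

    Write [d = N rho_N].  (A1) says that [1/d sum_j E_kj h_j] is close on
    average over [k] to [1/N sum_j W(k/N, j/N) h_j], uniformly over [|h| <= 1].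
    - Random signs [h] make the second sum of order [N^(-1/2)], while the first
      is at least [1/d] at every non-isolated vertex; hence [d -> oo].
    - [h = 1] and [h = mu_t] show that few vertices have a large degree or an
      inaccurate deterministic field, and [h = 1_B] shows that few vertices send
      more than [eta d] edges into a small set [B].  Iterating the latter gives
      increasing small exceptional sets [B_0, ..., B_T] depending on the graph
      only, not on the deviating agent.
    - Outside [B_t], a law of large numbers holds at time [t], uniformly over
      bounded test functions [f_j]:
      [E |1/d sum_j E_kj (f_j(X^j_t) - mu^j_t(f_j))| <= C_t eta].
      By induction on [t], conditionally on time [t] the noise has variance
      [O(1/d)], the drift is again of this form plus the field errors of the
      neighbours, neighbours in [B_t] contribute at most [2 eta], and the
      deviating agent at most [2/d].  *)
Require Import Defs.
From HB Require Import structures.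
From mathcomp Require Import all_boot all_order all_algebra.
From mathcomp Require Import all_classical all_reals all_analysis.
From mathcomp Require Import measurable_realfun.
From mathcomp Require Import ring lra.
Set Implicit Arguments.
Unset Strict Implicit.
Unset Printing Implicit Defensive.
Import Order.TTheory GRing.Theory Num.Theory.
Local Open Scope ring_scope.

(** * Expectations under product laws *)

Lemma eq_ler (R : numDomainType) (x y : R) : x = y -> x <= y.
Proof. by move->. Qed.

Section Expectation.
Variable R : realType.

Definition expect (S : finType) (p F : S -> R) : R := \sum_(s : S) p s * F s.

Section Basic.
Variables (S : finType) (p : S -> R).
Hypothesis pP : is_prob p.

Lemma eq_expect (F G : S -> R) : F =1 G -> expect p F = expect p G.
Proof. by move=> FG; apply: eq_bigr => s _; rewrite FG. Qed.

Lemma expectD (F G : S -> R) :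
  expect p (fun s => F s + G s) = expect p F + expect p G.
Proof. by rewrite -big_split /=; apply: eq_bigr => s _; rewrite mulrDr. Qed.

Lemma expectB (F G : S -> R) :
  expect p (fun s => F s - G s) = expect p F - expect p G.
Proof. by rewrite -sumrB; apply: eq_bigr => s _; rewrite mulrBr. Qed.

Lemma expectZ (c : R) (F : S -> R) :
  expect p (fun s => c * F s) = c * expect p F.
Proof. by rewrite /expect big_distrr; apply: eq_bigr => s _; rewrite mulrCA. Qed.

Lemma expect_cst (c : R) : expect p (fun=> c) = c.
Proof. by rewrite /expect -big_distrl /= pP.2 mul1r. Qed.

Lemma expect_sum (I : Type) (e : seq I) (Q : pred I) (F : I -> S -> R) :
  expect p (fun s => \sum_(i <- e | Q i) F i s) =
  \sum_(i <- e | Q i) expect p (F i).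
Proof.
rewrite exchange_big; apply: eq_bigr => s _.
by rewrite big_distrr.
Qed.

Lemma ler_expect (F G : S -> R) :
  (forall s, F s <= G s) -> expect p F <= expect p G.
Proof. by move=> FG; apply: ler_sum => s _; rewrite ler_wpM2l ?pP.1. Qed.

Lemma ler_norm_expect (F : S -> R) : `|expect p F| <= expect p (fun s => `|F s|).
Proof.
apply: (le_trans (ler_norm_sum _ _ _)); apply: ler_sum => s _.
by rewrite normrM (ger0_norm (pP.1 s)).
Qed.

Lemma expect_norm_le (F : S -> R) (M : R) :
  (forall s, `|F s| <= M) -> `|expect p F| <= M.
Proof.
move=> FM; apply: (le_trans (ler_norm_expect F)).
by rewrite -[leRHS]expect_cst; exact: ler_expect.
Qed.

End Basic.

(** An exchange of two finite sums. It turns the forward recursion of a law into the backward action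
    of its kernel on a test function, and it is used in this form for [fin_law], [sa_law] and the
    mean field. *)
Lemma expect_mix (S S' : finType) (p : S -> R) (K : S -> S' -> R) (F : S' -> R) :
  expect (fun s' => expect p (K ^~ s')) F = expect p (fun s => expect (K s) F).
Proof.
rewrite /expect; under eq_bigr do rewrite big_distrl /=.
rewrite exchange_big; apply: eq_bigr => s _; rewrite big_distrr /=.
by apply: eq_bigr => s' _; rewrite mulrA.
Qed.

Lemma is_prob_mix (S S' : finType) (p : S -> R) (K : S -> S' -> R) :
  is_prob p -> (forall s, is_prob (K s)) -> is_prob (fun s' => expect p (K ^~ s')).
Proof.
move=> pP KP; split=> [s'|].
  by apply: sumr_ge0 => s _; rewrite mulr_ge0 ?pP.1 ?(KP s).1.
have := expect_mix p K (fun=> 1); rewrite /expect.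
under eq_bigr do rewrite mulr1.
move=> ->; under eq_bigr do under eq_bigr do rewrite mulr1.
by under eq_bigr do rewrite (KP _).2 mulr1; exact: pP.2.
Qed.

(** * Product laws: marginals and weighted sums of independent variables *)

Section Product.
Variables (I S : finType) (q : I -> S -> R).
Hypothesis qP : forall i, is_prob (q i).

Definition prod_law (s : {ffun I -> S}) : R := \prod_(i : I) q i (s i).

(** Expanding a product of sums gives one term per configuration. The marginals below follow by
    taking all but one or two factors equal to 1. *)
Lemma expect_prod_law (h : I -> S -> R) :
  expect prod_law (fun s => \prod_(i : I) h i (s i)) =
  \prod_(i : I) expect (q i) (h i).
Proof. by rewrite bigA_distr_bigA; apply: eq_bigr => s _; rewrite -big_split. Qed.

Lemma prod_law_prob : is_prob prod_law.
Proof.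
split=> [s|]; first by apply: prodr_ge0 => i _; exact: (qP i).1.
rewrite -[LHS]bigA_distr_bigA big1// => i _; exact: (qP i).2.
Qed.

Lemma expect_marginal (j : I) (f : S -> R) :
  expect prod_law (fun s => f (s j)) = expect (q j) f.
Proof.
pose h i := if i == j then f else fun=> 1.
transitivity (expect prod_law (fun s => \prod_i h i (s i))).
  apply: eq_expect => s; rewrite (bigD1 j)//= big1 ?mulr1 /h ?eqxx// => i.
  by move/negbTE ->.
rewrite expect_prod_law (bigD1 j)//= big1 ?mulr1 /h ?eqxx// => i /negbTE ->.
exact: expect_cst.
Qed.

Lemma expect_marginal2 (j k : I) (f g : S -> R) : j != k ->
  expect prod_law (fun s => f (s j) * g (s k)) = expect (q j) f * expect (q k) g.
Proof.
move=> jk; have kj : (k == j) = false by rewrite eq_sym (negbTE jk).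
pose h i := if i == j then f else if i == k then g else fun=> 1.
transitivity (expect prod_law (fun s => \prod_i h i (s i))).
  apply: eq_expect => s; rewrite (bigD1 j)//= (bigD1 k) ?kj//=.
  rewrite /h !eqxx kj big1 ?mulr1// => i /andP[/negbTE -> /negbTE ->] //.
rewrite expect_prod_law (bigD1 j)//= (bigD1 k) ?kj//=.
rewrite /h !eqxx kj big1 ?mulr1// => i /andP[/negbTE -> /negbTE ->].
exact: expect_cst.
Qed.

Variables (c : I -> R) (Y : I -> S -> R).
Hypothesis Y0 : forall i, expect (q i) (Y i) = 0.

(** By independence and centring the cross terms vanish and only [i = j] survives. Besides the
    variance bound, this later extracts a single coefficient from a random signed sum. *)
Lemma expect_lin_mul (j : I) :
  expect prod_law (fun s => (\sum_i c i * Y i (s i)) * Y j (s j)) =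
  c j * expect (q j) (fun x => Y j x ^+ 2).
Proof.
under eq_expect do rewrite big_distrl /=.
rewrite expect_sum (bigD1 j)//= big1 ?addr0; last first.
  move=> i ij; under eq_expect do rewrite -mulrA.
  by rewrite expectZ expect_marginal2// !Y0 mul0r mulr0.
rewrite -(expect_marginal j (fun x => Y j x ^+ 2)) -expectZ.
by apply: eq_expect => s; rewrite -mulrA expr2.
Qed.

Lemma variance_lin : (forall i, expect (q i) (fun x => Y i x ^+ 2) <= 1) ->
  expect prod_law (fun s => (\sum_i c i * Y i (s i)) ^+ 2) <= \sum_i c i ^+ 2.
Proof.
move=> Y1; pose Z (s : {ffun I -> S}) := \sum_i c i * Y i (s i).
rewrite (@eq_expect _ _ _ (fun s => \sum_j c j * (Z s * Y j (s j)))); last first.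
  move=> s; rewrite expr2 -/(Z s) {2}/Z big_distrr.
  by apply: eq_bigr => j _; rewrite mulrCA.
rewrite expect_sum; apply: ler_sum => j _.
rewrite expectZ expect_lin_mul mulrA -expr2 ler_piMr ?sqr_ge0//.
Qed.

Lemma expect_abs_lin (e : R) : 0 < e ->
  (forall i, expect (q i) (fun x => Y i x ^+ 2) <= 1) -> \sum_i c i ^+ 2 <= e ^+ 2 ->
  expect prod_law (fun s => `|\sum_i c i * Y i (s i)|) <= e.
Proof.
move=> e0 Y1 ce.
(* This pointwise inequality plays the role of Cauchy-Schwarz: it passes from the second moment to
   the first without square roots. *)
have AMGM z : `|z| <= (2 * e)^-1 * z ^+ 2 + e / 2.
  have := sqr_ge0 (`|z| - e); rewrite sqrrB real_normK ?num_real// => zz.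
  rewrite -(ler_pM2l (_ : 0 < 2 * e)) ?mulr_gt0// mulrDr mulrA divff ?gt_eqF ?mulr_gt0//.
  rewrite mul1r; have -> : 2 * e * (e / 2) = e ^+ 2 by field.
  by move: zz; rewrite -mulr_natl; lra.
apply: (le_trans (ler_expect prod_law_prob (fun s => AMGM _))).
rewrite expectD (expect_cst prod_law_prob) expectZ.
have e20 : 0 <= (2 * e)^-1 by rewrite invr_ge0 mulr_ge0// ltW.
apply: (@le_trans _ _ ((2 * e)^-1 * e ^+ 2 + e / 2)).
  by rewrite lerD2r ler_wpM2l// (le_trans (variance_lin Y1) ce).
by apply: eq_ler; field; rewrite gt_eqF.
Qed.

End Product.

Lemma centered_mean (S : finType) (p f : S -> R) : is_prob p ->
  expect p (fun x => f x - expect p f) = 0.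
Proof. by move=> pP; rewrite expectB expect_cst// subrr. Qed.

(** The variance is the second moment minus the square of the mean, hence at most the second
    moment. *)
Lemma centered_sqr (S : finType) (p f : S -> R) : is_prob p ->
  (forall x, `|f x| <= 1) -> expect p (fun x => (f x - expect p f) ^+ 2) <= 1.
Proof.
move=> pP f1; set m := expect p f.
rewrite (@eq_expect _ _ _ (fun x => f x ^+ 2 + (- (2 * m) * f x + m ^+ 2))); last first.
  by move=> x; ring.
rewrite expectD expectD expectZ expect_cst// -/m.
have : expect p (fun x => f x ^+ 2) <= 1.
  rewrite -[leRHS](expect_cst pP); apply: ler_expect => // x.
  by rewrite -real_normK ?num_real// expr_le1.
by have := sqr_ge0 m; rewrite expr2; lra.
Qed.

End Expectation.

(** * One-step analysis of the finite game *)

Section FiniteGame.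
Variables (R : realType) (X U : finType).
Variables (N : nat) (E : 'I_N -> 'I_N -> bool) (rho : R).
Variables (P : X -> U -> (X -> R) -> X -> R) (mu0 : X -> R).
Hypotheses (Pok : kernel_ok P) (mu0P : is_prob mu0) (rho0 : 0 < rho).

(** The weights for which [Gfin] is a weighted empirical measure, see [GfinE]; [N%:R * rho] is the
    degree scale [d]. *)
Definition adj_weight (k j : 'I_N) : R := (E k j)%:R / (N%:R * rho).

Definition agent_kernel (p : X -> U -> R) (nu : X -> R) (x y : X) : R :=
  expect (p x) (fun u => P x u nu y).

Lemma agent_kernel_prob (p : X -> U -> R) nu x :
  is_prob (p x) -> is_bmeas nu -> is_prob (agent_kernel p nu x).
Proof. by move=> px nu0; apply: is_prob_mix => // u; exact: Pok. Qed.

Lemma expect_agent_kernel (p : X -> U -> R) nu x f :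
  expect (agent_kernel p nu x) f = expect (p x) (fun u => expect (P x u nu) f).
Proof. exact: expect_mix. Qed.

Lemma adj_weight_ge0 k j : 0 <= adj_weight k j.
Proof. by rewrite mulr_ge0// invr_ge0 mulr_ge0// ltW. Qed.

Lemma adj_weight_le k j : adj_weight k j <= (N%:R * rho)^-1.
Proof.
have d0 : 0 <= (N%:R * rho)^-1 by rewrite invr_ge0 mulr_ge0// ltW.
by rewrite /adj_weight ler_piMl// lern1 leq_b1.
Qed.

(** Each weight is 0 or [1/d], so squaring it multiplies it by [1/d]. This is the source of the
    variance of order [1/d]. *)
Lemma sum_sqr_adj_weight k :
  \sum_j adj_weight k j ^+ 2 = (N%:R * rho)^-1 * \sum_j adj_weight k j.
Proof.
rewrite big_distrr; apply: eq_bigr => j _ /=.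
by rewrite /adj_weight; case: (E k j); rewrite ?mul1r ?expr2// !mul0r mulr0.
Qed.

Lemma GfinE (s : {ffun 'I_N -> X}) k x :
  Gfin E rho s k x = \sum_j adj_weight k j * (s j == x)%:R.
Proof.
rewrite /Gfin -sum1_card natr_sum big_distrr /= [LHS]big_mkcond /=.
apply: eq_bigr => j _; rewrite unfold_in /= asboolb /adj_weight.
by case: (E k j); case: (s j == x); rewrite /= ?mulr1 ?mul1r ?mulr0 ?mul0r.
Qed.

Lemma Gfin_bmeas (s : {ffun 'I_N -> X}) k : is_bmeas (Gfin E rho s k).
Proof.
by move=> x; rewrite GfinE; apply: sumr_ge0 => j _; rewrite mulr_ge0 ?adj_weight_ge0.
Qed.

(** * The joint law as a Markov chain with product transitions *)

Section Law.
Variables (T : nat) (pis : 'I_N -> nat -> X -> U -> R).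
Hypothesis pisP : forall j, is_policy T (pis j).

Definition next_kernel t (s : {ffun 'I_N -> X}) (j : 'I_N) : X -> R :=
  agent_kernel (pis j t) (Gfin E rho s j) (s j).

(** Given the configuration [s], the agents act and move independently, so the sum over joint
    actions factors into one sum per agent. *)
Lemma fin_lawS t s' :
  fin_law E rho P mu0 pis t.+1 s' =
  expect (fin_law E rho P mu0 pis t) (fun s => prod_law (next_kernel t s) s').
Proof.
apply: eq_bigr => s _; congr (_ * _); rewrite /prod_law bigA_distr_bigA.
by apply: eq_bigr => a _; rewrite -big_split.
Qed.

Lemma next_kernel_prob t s j : (t < T)%N -> is_prob (next_kernel t s j).
Proof. by move=> tT; apply: agent_kernel_prob; [exact: pisP | exact: Gfin_bmeas]. Qed.

Lemma fin_law_prob t : (t <= T)%N -> is_prob (fin_law E rho P mu0 pis t).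
Proof.
elim: t => [|t IH] tT; first exact: (prod_law_prob (fun=> mu0P)).
have [p0 p1] := is_prob_mix (IH (ltnW tT))
  (fun s => prod_law_prob (fun j => next_kernel_prob s j tT)).
split=> [s'|]; first by rewrite fin_lawS.
by rewrite -[RHS]p1; apply: eq_bigr => s' _; rewrite fin_lawS.
Qed.

Lemma expect_fin_lawS t (F : {ffun 'I_N -> X} -> R) :
  expect (fin_law E rho P mu0 pis t.+1) F =
  expect (fin_law E rho P mu0 pis t)
    (fun s => expect (prod_law (next_kernel t s)) F).
Proof. by rewrite -expect_mix; apply: eq_bigr => s' _; rewrite fin_lawS. Qed.

End Law.

(** * Law of large numbers off the exceptional sets, with one deviating agent *)

Section Concentration.
Variables (T : nat) (pib pis : 'I_N -> nat -> X -> U -> R) (i : 'I_N).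
Hypothesis pibP : forall j, is_policy T (pib j).
Hypothesis pisP : forall j, is_policy T (pis j).
Hypothesis pisE : forall j, j != i -> pis j = pib j.
Variables g m : 'I_N -> nat -> X -> R.
Hypothesis g0 : forall j t, (t < T)%N -> is_bmeas (g j t).
Hypothesis m_init : forall j x, (0 < T)%N -> m j 0%N x = mu0 x.
Hypothesis m_step : forall j t y, (t.+1 < T)%N ->
  m j t.+1 y = expect (m j t) (fun x => agent_kernel (pib j t) (g j t) x y).
Variables (L K eta : R).
Hypotheses (L0 : 0 <= L) (K0 : 0 <= K) (eta0 : 0 < eta).
Hypothesis Plip : forall x u nu nu', is_bmeas nu -> is_bmeas nu' ->
  l1 (fun y => P x u nu y - P x u nu' y) <= L * l1 (fun y => nu y - nu' y).
Variable B : nat -> {set 'I_N}.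
Hypothesis Bmono : forall t, B t \subset B t.+1.
Hypothesis Bdeg : forall t k, k \notin B t -> \sum_j adj_weight k j <= K.
Hypothesis Bnbr : forall t k, k \notin B t.+1 -> \sum_(j in B t) adj_weight k j <= eta.
Hypothesis Bmf : forall t k, (t < T)%N -> k \notin B t ->
  \sum_x `|\sum_j adj_weight k j * m j t x - g k t x| <= eta.
Hypothesis inv_le : (N%:R * rho)^-1 <= eta.
Hypothesis var_le : (N%:R * rho)^-1 * K <= eta ^+ 2.

(** In units of [eta], the 5 is 1 for the noise, 2 for the deviating agent and 2 for the neighbours
    in [B t]. The next term is the drift, and the last is the field error of the remaining
    neighbours, of total weight at most [K]. *)
Fixpoint lln_const (t : nat) : R :=
  if t is t'.+1 then 5 + lln_const t' + K * (L * (#|X|%:R * lln_const t' + 1))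
  else 1.

Definition mf_const (t : nat) : R := #|X|%:R * lln_const t + 1.

Local Notation law := (fin_law E rho P mu0 pis).

Lemma lln_const_ge0 t : 0 <= lln_const t.
Proof. by elim: t => //= t IH; rewrite !(addr_ge0, mulr_ge0). Qed.

(** A test function bounded by 1 sees at most the L1 distance of the two transition laws; averaging
    over the action keeps this bound. *)
Lemma expect_lip (p : X -> U -> R) nu nu' x f :
  is_prob (p x) -> is_bmeas nu -> is_bmeas nu' -> (forall y, `|f y| <= 1) ->
  `|expect (agent_kernel p nu x) f - expect (agent_kernel p nu' x) f| <=
  L * l1 (fun y => nu y - nu' y).
Proof.
move=> px nu0 nu'0 f1; rewrite !expect_agent_kernel -expectB.
apply: (expect_norm_le px) => u; apply: le_trans (Plip x u nu0 nu'0).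
rewrite /expect -sumrB; apply: (le_trans (ler_norm_sum _ _ _)).
by apply: ler_sum => y _; rewrite -mulrBl normrM ler_piMr.
Qed.

(** The variance is at most the sum of the squared weights, that is [1/d] times the normalised
    degree of [k], hence at most [eta ^+ 2] by [var_le]. *)
Lemma noise_bound (q : 'I_N -> X -> R) (f : 'I_N -> X -> R) t k :
  (forall j, is_prob (q j)) -> (forall j x, `|f j x| <= 1) -> k \notin B t ->
  expect (prod_law q)
    (fun s => `|\sum_j adj_weight k j * (f j (s j) - expect (q j) (f j))|) <= eta.
Proof.
move=> qP f1 kB.
apply: (expect_abs_lin qP (c := adj_weight k)
  (Y := fun j x => f j x - expect (q j) (f j))) => // [j|j|].
- exact: centered_mean.
- exact: centered_sqr.
rewrite sum_sqr_adj_weight; apply: le_trans var_le.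
by rewrite ler_wpM2l ?(Bdeg kB)// invr_ge0 mulr_ge0// ltW.
Qed.

(** The test function may depend on the agent. The induction requires this, since pulling a test
    function back through one step involves the policy and the field of each agent. *)
Definition lln_at t : Prop := forall f : 'I_N -> X -> R,
  (forall j x, `|f j x| <= 1) -> forall k, k \notin B t ->
  expect (law t) (fun s =>
    `|\sum_j adj_weight k j * (f j (s j) - expect (m j t) (f j))|)
  <= lln_const t * eta.

Lemma expect_indic (S : finType) (p : S -> R) x :
  expect p (fun y => (y == x)%:R) = p x.
Proof.
rewrite /expect (bigD1 x)//= eqxx mulr1 big1 ?addr0// => y /negbTE ->.
by rewrite mulr0.
Qed.

(** The indicators of the states serve as test functions, one [lln_const] for each; the gap of the
    deterministic field, bounded by [Bmf], adds the final 1 of [mf_const]. *)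
Lemma lln_mf t k : (t < T)%N -> lln_at t -> k \notin B t ->
  expect (law t) (fun s => l1 (fun y => Gfin E rho s k y - g k t y))
  <= mf_const t * eta.
Proof.
move=> tT lln kB; have lP := fin_law_prob pisP (ltnW tT).
rewrite expect_sum.
apply: (@le_trans _ _ (\sum_x (lln_const t * eta +
    `|\sum_j adj_weight k j * m j t x - g k t x|))); last first.
  rewrite big_split /= sumr_const -[X in X + _]mulr_natl mulrA.
  by rewrite /mf_const mulrDl mul1r lerD2l Bmf.
apply: ler_sum => x _.
have f1 (j : 'I_N) (y : X) : `|(y == x)%:R : R| <= 1.
  by case: (y == x); rewrite ?normr0 ?normr1.
apply: le_trans (lerD (lln _ f1 k kB) (lexx _)).
rewrite -[X in _ <= _ + X](expect_cst lP) -expectD; apply: (ler_expect lP) => s.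
rewrite GfinE; apply: le_trans (ler_normD _ _).
apply: eq_ler; congr (`|_|).
rewrite addrA; congr (_ - _); rewrite -big_split /=; apply: eq_bigr => j _.
by rewrite -mulrDr expect_indic subrK.
Qed.

(** Two expectations of a function bounded by 1 differ by at most 2, which suffices for the
    deviating agent and for [B t]. Any other agent uses the reference policy, so only the field
    differs and the kernel is Lipschitz in it. *)
Lemma kernel_error t (f : 'I_N -> X -> R) s j :
  (t < T)%N -> (forall j x, `|f j x| <= 1) ->
  `|expect (next_kernel pis t s j) (f j)
    - expect (agent_kernel (pib j t) (g j t) (s j)) (f j)| <=
  2 * (j == i)%:R + 2 * (j \in B t)%:R +
  (j \notin B t)%:R * (L * l1 (fun y => Gfin E rho s j y - g j t y)).
Proof.
move=> tT f1.
have l0 : 0 <= L * l1 (fun y => Gfin E rho s j y - g j t y).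
  by rewrite mulr_ge0// sumr_ge0.
have trivial_bound : `|expect (next_kernel pis t s j) (f j)
    - expect (agent_kernel (pib j t) (g j t) (s j)) (f j)| <= 2.
  apply: le_trans (ler_normB _ _) _; rewrite -[2]/(1 + 1) lerD//.
    apply: expect_norm_le => //; exact: next_kernel_prob pisP _ _ _ tT.
  apply: expect_norm_le => //; apply: agent_kernel_prob; last exact: g0.
  exact: pibP.
have [ji|ji] := eqVneq j i.
  by move: trivial_bound l0; case: (j \in B t) => /=; lra.
case: (boolP (j \in B t)) => jB /=.
  by move: trivial_bound; lra.
rewrite !mulr0 !add0r mul1r /next_kernel pisE//.
by apply: expect_lip => //; [exact: pibP | exact: Gfin_bmeas | exact: g0].
Qed.

Lemma lln_step t : (t.+1 < T)%N -> lln_at t -> lln_at t.+1.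
Proof.
move=> tT lln f f1 k kB; have tT' := ltnW tT.
have lP := fin_law_prob pisP (ltnW tT').
have kB' : k \notin B t by apply: contra kB; exact: (fintype.subsetP (Bmono t)).
(* The backward image of [f j] under one mean field step; it is again bounded by 1, so the induction
   hypothesis applies to it. *)
pose phi j x := expect (agent_kernel (pib j t) (g j t) x) (f j).
have phi1 j x : `|phi j x| <= 1.
  apply: expect_norm_le => //; apply: agent_kernel_prob; last exact: g0.
  exact: pibP.
have mphi j : expect (m j t.+1) (f j) = expect (m j t) (phi j).
  by rewrite -expect_mix; apply: eq_bigr => y _; rewrite m_step.
(* The deviation at time [t.+1] splits into the noise [A], centred given [s], the kernel error [D],
   and [F], which is a deviation at time [t] for the test functions [phi]. *)
pose A s (s' : {ffun 'I_N -> X}) := \sum_j adj_weight k j *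
  (f j (s' j) - expect (next_kernel pis t s j) (f j)).
pose D s := \sum_j adj_weight k j *
  (expect (next_kernel pis t s j) (f j) - phi j (s j)).
pose F s := \sum_j adj_weight k j * (phi j (s j) - expect (m j t) (phi j)).
pose b j s := 2 * (j == i)%:R + 2 * (j \in B t)%:R +
  (j \notin B t)%:R * (L * l1 (fun y => Gfin E rho s j y - g j t y)).
rewrite expect_fin_lawS.
apply: (@le_trans _ _ (expect (law t) (fun s =>
  (eta + `|F s|) + \sum_j adj_weight k j * b j s))).
  apply: (ler_expect lP) => s.
  have nP := prod_law_prob (fun j => next_kernel_prob pisP s j tT').
  apply: (@le_trans _ _ (expect (prod_law (next_kernel pis t s))
    (fun s' => `|A s s'| + (`|D s| + `|F s|)))).
    apply: (ler_expect nP) => s'.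
    have -> : \sum_j adj_weight k j * (f j (s' j) - expect (m j t.+1) (f j)) =
              A s s' + (D s + F s).
      rewrite -!big_split; apply: eq_bigr => j _ /=.
      by rewrite -!mulrDr mphi !addrA !subrK.
    by rewrite (le_trans (ler_normD _ _))// lerD2l ler_normD.
  rewrite expectD (expect_cst nP) addrA [leRHS]addrAC lerD2r lerD//.
    by apply: (noise_bound _ f1 kB') => j; exact: next_kernel_prob pisP _ _ _ tT'.
  apply: (le_trans (ler_norm_sum _ _ _)); apply: ler_sum => j _.
  rewrite normrM ger0_norm ?adj_weight_ge0// ler_wpM2l ?adj_weight_ge0//.
  exact: kernel_error.
rewrite !expectD (expect_cst lP) expect_sum.
have Fb := lln phi phi1 k kB'.
have bb : \sum_j expect (law t) (fun s => adj_weight k j * b j s) <=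
    2 * eta + 2 * eta + K * (L * (mf_const t * eta)).
  apply: (@le_trans _ _ (\sum_j (2 * (adj_weight k j * (j == i)%:R) +
      2 * (adj_weight k j * (j \in B t)%:R) +
      adj_weight k j * (L * (mf_const t * eta))))).
    apply: ler_sum => j _; rewrite expectZ.
    rewrite ![2 * (adj_weight _ _ * _)]mulrCA -!mulrDr ler_wpM2l ?adj_weight_ge0//.
    rewrite /b expectD (expect_cst lP) -mulrDr lerD2l.
    have c0 : 0 <= mf_const t * eta.
      by rewrite mulr_ge0 ?(ltW eta0)// addr_ge0// mulr_ge0// lln_const_ge0.
    (* Nothing is known about the field of a neighbour in [B t], whose cost is already counted by
       the trivial bound; off [B t] the field error is controlled by [lln_mf]. *)
    case: (boolP (j \in B t)) => jB /=.
      under eq_expect do rewrite mul0r.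
      by rewrite expect_cst// mulr_ge0.
    under eq_expect do rewrite mul1r.
    by rewrite expectZ ler_wpM2l// lln_mf.
  rewrite !big_split /= -!big_distrr -big_distrl /=.
  rewrite lerD//; last first.
    rewrite ler_wpM2r ?(Bdeg kB)// mulr_ge0// mulr_ge0 ?(ltW eta0)//.
    by rewrite addr_ge0// mulr_ge0// lln_const_ge0.
  rewrite lerD// ler_wpM2l//.
    rewrite (bigD1 i)//= eqxx mulr1 big1 ?addr0; last first.
      by move=> j /negbTE ->; rewrite mulr0.
    exact: le_trans (adj_weight_le _ _) inv_le.
  apply: le_trans (Bnbr kB); apply: eq_ler.
  rewrite [RHS]big_mkcond; apply: eq_bigr => j _.
  by case: (j \in B t); rewrite ?mulr1 ?mulr0.
apply: (le_trans (lerD (lerD (lexx eta) Fb) bb)).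
by rewrite /= -/(mf_const t); apply: eq_ler; ring.
Qed.

Lemma lln t : (t < T)%N -> lln_at t.
Proof.
elim: t => [T0 f f1 k kB|t IH tT]; last exact: (lln_step tT (IH (ltnW tT))).
rewrite /= mul1r.
apply: le_trans (noise_bound (fun=> mu0P) f1 kB).
apply: eq_ler; apply: eq_expect => s.
congr (`|_|); apply: eq_bigr => j _; congr (_ * (_ - _)).
by apply: eq_bigr => x _; rewrite m_init.
Qed.

Lemma mean_field_error t k : (t < T)%N -> k \notin B t ->
  expect (law t) (fun s => l1 (fun y => Gfin E rho s k y - g k t y))
  <= mf_const t * eta.
Proof. by move=> tT; apply: lln_mf => //; exact: lln. Qed.

End Concentration.

(** * Comparison of the payoff of one agent with a single-agent decision problem *)

Section Payoff.
Variables (T : nat) (pis : 'I_N -> nat -> X -> U -> R) (i : 'I_N).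
Hypothesis pisP : forall j, is_policy T (pis j).
Variables (r : X -> U -> (X -> R) -> R) (gam : nat -> X -> R).
Hypothesis gam0 : forall t, (t < T)%N -> is_bmeas (gam t).
Variables (L Lr M e : R).
Hypotheses (L0 : 0 <= L) (Lr0 : 0 <= Lr) (M0 : 0 < M).
Hypothesis Plip : forall x u nu nu', is_bmeas nu -> is_bmeas nu' ->
  l1 (fun y => P x u nu y - P x u nu' y) <= L * l1 (fun y => nu y - nu' y).
Hypothesis rlip : forall x u nu nu', is_bmeas nu -> is_bmeas nu' ->
  `|r x u nu - r x u nu'| <= Lr * l1 (fun y => nu y - nu' y).
Hypothesis rM : forall t x u, (t < T)%N -> `|r x u (gam t)| <= M.

Local Notation law := (fin_law E rho P mu0 pis).

Hypothesis gam_err : forall t, (t < T)%N ->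
  expect (law t) (fun s => l1 (fun y => Gfin E rho s i y - gam t y)) <= e.

(** Replacing the random field by [gam] costs at most [L * e] per step, and the costs add up over
    time. Any policy of agent [i] is allowed, so deviations are covered. *)
Lemma single_agent_law t (f : X -> R) : (t < T)%N -> (forall x, `|f x| <= 1) ->
  `|expect (law t) (fun s => f (s i)) - expect (sa_law P mu0 gam (pis i) t) f|
  <= t%:R * (L * e).
Proof.
elim: t f => [|t IH] f tT f1.
  rewrite mul0r [X in `|X - _|](expect_marginal (fun=> mu0P)).
  by rewrite subrr normr0.
have tT' := ltnW tT; have lP := fin_law_prob pisP (ltnW tT').
pose psi x := expect (agent_kernel (pis i t) (gam t) x) f.
have psi1 x : `|psi x| <= 1.
  apply: expect_norm_le => //; apply: agent_kernel_prob; last exact: gam0.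
  exact: pisP.
have -> : expect (sa_law P mu0 gam (pis i) t.+1) f =
          expect (sa_law P mu0 gam (pis i) t) psi by exact: expect_mix.
rewrite expect_fin_lawS.
(* The inserted term moves agent [i] one step with the field [gam t] from its true law. One
   difference is then a one-step kernel error, the other is the induction hypothesis for [psi]. *)
rewrite -(subrK (expect (law t) (fun s => psi (s i))) (expect _ _)) -addrA.
apply: (le_trans (ler_normD _ _)); rewrite -natr1 mulrDl mul1r [leRHS]addrC.
apply: lerD; last exact: IH.
rewrite -expectB; apply: (le_trans (ler_norm_expect lP _)).
apply: (@le_trans _ _ (expect (law t)
    (fun s => L * l1 (fun y => Gfin E rho s i y - gam t y)))); last first.
  by rewrite expectZ ler_wpM2l// gam_err.
apply: (ler_expect lP) => s.
rewrite (expect_marginal (fun j => next_kernel_prob pisP s j tT')).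
by apply: expect_lip => //; [exact: pisP | exact: Gfin_bmeas | exact: gam0].
Qed.

Lemma payoff_error :
  `|JN E rho T P r mu0 pis i -
    \sum_(t < T) expect (sa_law P mu0 gam (pis i) t)
      (fun x => expect (pis i t x) (fun u => r x u (gam t)))|
  <= T%:R * (Lr * e + M * (T%:R * (L * e))).
Proof.
rewrite -sumrB; apply: (le_trans (ler_norm_sum _ _ _)).
rewrite mulr_natl -[X in _ *+ X](card_ord T) -sumr_const; apply: ler_sum => t _.
have tT := ltn_ord t; have lP := fin_law_prob pisP (ltnW tT).
have e0 : 0 <= e.
  apply: le_trans (gam_err tT); rewrite -(expect_cst lP 0).
  by apply: (ler_expect lP) => s; exact: sumr_ge0.
pose R_ (x : X) := expect (pis i t x) (fun u => r x u (gam t)).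
(* [single_agent_law] asks for test functions bounded by 1, so the averaged reward is divided by its
   bound [M]. *)
have RM x : `|M^-1 * R_ x| <= 1.
  rewrite normrM gtr0_norm ?invr_gt0// mulrC ler_pdivrMr// mul1r.
  by apply: expect_norm_le => [|u]; [exact: pisP | exact: rM].
rewrite -(subrK (expect (law t) (fun s => R_ (s i)))
  (\sum_(s : {ffun 'I_N -> X}) _)) -addrA.
apply: (le_trans (ler_normD _ _)); apply: lerD; last first.
  have := single_agent_law tT RM; rewrite !expectZ -mulrBr normrM.
  rewrite gtr0_norm ?invr_gt0// mulrC ler_pdivrMr// mulrC => /le_trans; apply.
  by rewrite ler_pM2l// ler_wpM2r ?mulr_ge0// ler_nat ltnW.
rewrite -[X in X - _]/(expect (law t) _) -expectB.
apply: (le_trans (ler_norm_expect lP _)).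
apply: (@le_trans _ _ (expect (law t)
    (fun s => Lr * l1 (fun y => Gfin E rho s i y - gam t y)))); last first.
  by rewrite expectZ ler_wpM2l// gam_err.
apply: (ler_expect lP) => s.
rewrite [X in X - _](expect_marginal (q := fun j => pis j t (s j))
  (fun j => pisP j (s j) tT) i (fun u => r (s i) u (Gfin E rho s i))).
rewrite -expectB; apply: expect_norm_le => [|u]; first exact: pisP.
by apply: rlip; [exact: Gfin_bmeas | exact: gam0].
Qed.

End Payoff.

End FiniteGame.

(** * Exceptional vertices of a graph close to a bounded kernel *)

Section DiscreteKernel.
Variables (R : realType) (N : nat) (E : 'I_N -> 'I_N -> bool) (rho : R).
Variables (w : 'I_N -> 'I_N -> R) (C delta : R).
Hypotheses (N0 : (0 < N)%N) (rho0 : 0 < rho) (C0 : 0 <= C).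
Hypothesis wC : forall k j, `|w k j| <= C.

Local Notation adj := (adj_weight E rho).

Hypothesis close : forall h : 'I_N -> R, (forall j, `|h j| <= 1) ->
  \sum_k `|\sum_j adj k j * h j - N%:R^-1 * \sum_j w k j * h j| <= N%:R * delta.

Let NR0 : 0 < N%:R :> R. Proof. by rewrite ltr0n. Qed.
Let d0 : 0 < N%:R * rho. Proof. exact: mulr_gt0. Qed.

Lemma sum_ord_cst (n : nat) (c : R) : \sum_(k < n) c = n%:R * c.
Proof. by rewrite sumr_const card_ord mulr_natl. Qed.

Lemma card_bigcup_le (I S : finType) (F : I -> {set S}) :
  (#|\bigcup_i F i| <= \sum_i #|F i|)%N.
Proof.
elim/big_rec2: _ => [|i n A _ IH]; first by rewrite cards0.
by rewrite (leq_trans (leq_card_setU _ _))// leq_add2l.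
Qed.

Lemma card_gt_le (f : 'I_N -> R) (e : R) :
  (forall k, 0 <= f k) -> e * #|[set k | e < f k]|%:R <= \sum_k f k.
Proof.
move=> f0; rewrite (bigID (mem [set k | e < f k]))/=.
rewrite -[leLHS]addr0 lerD ?sumr_ge0//.
rewrite mulr_natr -sumr_const; apply: ler_sum => k.
by rewrite inE => /ltW.
Qed.

(** The weights are compared with [w], whose row applied to [h] contributes at most [C / N%:R * c].
    Restricting the rows to [S] keeps the factor [#|S|], which the degree estimate exploits. *)
Lemma sum_row_bound (h : 'I_N -> R) (c : R) (S : {set 'I_N}) :
  (forall j, 0 <= h j <= 1) -> \sum_j h j <= c ->
  \sum_(k in S) \sum_j adj k j * h j <= N%:R * delta + #|S|%:R * (C / N%:R * c).
Proof.
move=> h01 hc.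
have h1 j : `|h j| <= 1 by case/andP: (h01 j) => *; rewrite ger0_norm.
apply: (@le_trans _ _ (\sum_(k in S)
  (`|\sum_j adj k j * h j - N%:R^-1 * \sum_j w k j * h j| + C / N%:R * c))).
  apply: ler_sum => k _; rewrite -lerBlDr; apply: le_trans (ler_norm _).
  rewrite lerD2l lerN2 mulrAC [leRHS]mulrC ler_wpM2l ?invr_ge0 ?(ltW NR0)//.
  apply: (@le_trans _ _ (\sum_j C * h j)).
    apply: ler_sum => j _; rewrite ler_wpM2r//; first by case/andP: (h01 j).
    exact: le_trans (ler_norm _) (wC _ _).
  by rewrite -big_distrr ler_wpM2l.
rewrite big_split /= sumr_const -[X in _ + X <= _]mulr_natl lerD2r.
apply: le_trans (close h1).
by rewrite [leRHS](bigID (mem S))/= lerDl sumr_ge0.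
Qed.

(** * Divergence of the degree scale, by random signs *)

Section Degrees.
Variables (c2 e : R).
Hypotheses (c20 : 0 < c2) (e0 : 0 < e).
Hypothesis rho_edges : rho <= c2 * ((nedges E)%:R / N%:R ^+ 2).
Hypothesis Ce : C ^+ 2 / N%:R <= e ^+ 2.

Let nonisolated : {set 'I_N} := [set k | [exists j, E k j]].

Let sgn (b : bool) : R := if b then 1 else -1.
Let coin : 'I_N -> bool -> R := fun _ _ => 2^-1.

Let coin_prob j : is_prob (coin j).
Proof.
split=> [b|]; first by rewrite invr_ge0.
by rewrite big_bool /= /coin; field.
Qed.

Let sgn_mean (j : 'I_N) : expect (coin j) sgn = 0.
Proof. by rewrite /expect big_bool /= mulr1 mulrN1 subrr. Qed.

Let sgn_var (j : 'I_N) : expect (coin j) (fun b => sgn b ^+ 2) = 1.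
Proof. by rewrite /expect big_bool /= sqrrN !expr1n /coin; field. Qed.

(** Both operators are averaged over random signs. A non-isolated row of the graph contributes at
    least one coefficient [1/d], whereas every row of [w] contributes at most [e], since its squared
    coefficients sum to at most [C ^+ 2 / N%:R]. *)
Lemma card_nonisolated :
  #|nonisolated|%:R * (N%:R * rho)^-1 <= N%:R * delta + N%:R * e.
Proof.
have pP := prod_law_prob coin_prob.
apply: (@le_trans _ _ (\sum_k expect (prod_law coin)
  (fun s => `|\sum_j adj k j * sgn (s j)|))).
  rewrite mulr_natl -sumr_const [leRHS](bigID (mem nonisolated))/=.
  rewrite -[leLHS]addr0 lerD//; last first.
    apply: sumr_ge0 => k _; rewrite -(expect_cst pP 0).
    exact: ler_expect.
  apply: ler_sum => k; rewrite inE => /existsP[j Ekj].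
  have -> : (N%:R * rho)^-1 = adj k j by rewrite /adj_weight Ekj mul1r.
  (* Multiplication by the sign of [j] isolates [adj k j] without changing the absolute value of the
     sum. *)
  have := expect_lin_mul coin_prob (adj k) sgn_mean j.
  rewrite sgn_var mulr1 => <-; apply: le_trans (ler_norm _) _.
  apply: le_trans (ler_norm_expect pP _) _; apply: (ler_expect pP) => s.
  by rewrite normrM ler_piMr// /sgn; case: (s j); rewrite ?normrN normr1.
apply: (@le_trans _ _ (expect (prod_law coin) (fun s =>
    \sum_k `|\sum_j adj k j * sgn (s j) - N%:R^-1 * \sum_j w k j * sgn (s j)|)
  + \sum_k expect (prod_law coin)
    (fun s => `|\sum_j (N%:R^-1 * w k j) * sgn (s j)|))).
  rewrite expect_sum -big_split; apply: ler_sum => k _ /=.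
  rewrite -expectD; apply: (ler_expect pP) => s.
  have -> : N%:R^-1 * \sum_j w k j * sgn (s j) =
      \sum_j N%:R^-1 * w k j * sgn (s j).
    by rewrite big_distrr /=; apply: eq_bigr => j _; rewrite mulrA.
  rewrite -{1}(subrK (\sum_j N%:R^-1 * w k j * sgn (s j))
    (\sum_j adj k j * sgn (s j))).
  exact: ler_normD.
apply: lerD.
  rewrite -[leRHS](expect_cst pP); apply: (ler_expect pP) => s.
  by apply: close => j; rewrite /sgn; case: (s j); rewrite ?normrN normr1.
rewrite -[leRHS]sum_ord_cst; apply: ler_sum => k _.
apply: (expect_abs_lin coin_prob (Y := fun=> sgn)) => // [j|]; first by rewrite sgn_var.
apply: le_trans Ce.
apply: (@le_trans _ _ (\sum_(j < N) (N%:R^-1 * C) ^+ 2)).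
  apply: ler_sum => j _; rewrite -[leLHS]real_normK ?num_real//.
  have nw : `|N%:R^-1 * w k j| <= N%:R^-1 * C.
    by rewrite normrM gtr0_norm ?invr_gt0// ler_wpM2l// invr_ge0 ltW.
  by rewrite lerXn2r// nnegrE// (le_trans _ nw).
rewrite sum_ord_cst exprMn.
by apply: eq_ler; field; rewrite gt_eqF.
Qed.

Lemma nedges_le : (nedges E)%:R <= \sum_k \sum_j (E k j)%:R :> R.
Proof.
rewrite pair_big /= /nedges -sum1_card natr_sum big_mkcond /=.
apply: ler_sum => -[k j] _ /=; rewrite unfold_in /= asboolb.
by case: (E k j) => //=; case: ifP.
Qed.

(** All edges start at non-isolated vertices, which number at most [N * (delta + e) * d]; the row
    bound then limits the number of edges, and the density hypothesis turns this into a bound on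
    [rho], which is divided out. With [delta] and [e] small, [d] must be large. *)
Lemma mean_degree_lower :
  1 <= c2 * (delta + C * (N%:R * rho) * (delta + e)).
Proof.
have degS : \sum_k \sum_j (E k j)%:R =
    N%:R * rho * \sum_(k in nonisolated) \sum_j adj k j * 1.
  rewrite big_distrr [RHS]big_mkcond; apply: eq_bigr => k _ /=.
  rewrite inE; case: ifPn => [_|/existsPn Ek].
    rewrite big_distrr; apply: eq_bigr => j _ /=.
    by rewrite mulr1 mulrC divfK ?gt_eqF.
  by rewrite big1// => j _; rewrite (negbTE (Ek j)).
have h01 (j : 'I_N) : 0 <= (1 : R) <= 1 by rewrite ler01 lexx.
have sum1 : \sum_(j < N) 1 <= N%:R :> R by rewrite sumr_const card_ord.
have := sum_row_bound nonisolated h01 sum1; rewrite divfK ?gt_eqF// => rows.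
have edges : (nedges E)%:R <=
    N%:R * rho * (N%:R * delta + #|nonisolated|%:R * C).
  by apply: le_trans nedges_le _; rewrite degS ler_wpM2l// ltW.
have cardS : #|nonisolated|%:R <= N%:R * (delta + e) * (N%:R * rho).
  by rewrite -ler_pdivrMr// mulrDr card_nonisolated.
rewrite -(ler_pM2l rho0) mulr1; apply: le_trans rho_edges _.
rewrite [leRHS]mulrCA ler_wpM2l ?(ltW c20)// ler_pdivrMr ?exprn_gt0//.
apply: le_trans edges _; apply: (@le_trans _ _ (N%:R * rho *
    (N%:R * delta + N%:R * (delta + e) * (N%:R * rho) * C))).
  by rewrite ler_wpM2l ?(ltW d0)// lerD2l ler_wpM2r.
by apply: eq_ler; ring.
Qed.

End Degrees.

(** * The increasing exceptional sets and their size *)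

Section BadSets.
Variables (X : finType) (T : nat) (g m : 'I_N -> nat -> X -> R) (eta : R).
Hypothesis eta0 : 0 < eta.
Hypothesis m01 : forall j t x, (t < T)%N -> 0 <= m j t x <= 1.
Hypothesis riemann : forall k t, (t < T)%N ->
  \sum_x `|N%:R^-1 * (\sum_j w k j * m j t x) - g k t x| <= eta / 2.

Let mf_gap k t := \sum_x `|\sum_j adj k j * m j t x - g k t x|.

(** The field gaps of all times already enter at level 0, so that degree and gap bounds hold off
    every level; later levels only add vertices with too much weight into the previous one. *)
Fixpoint bad (t : nat) : {set 'I_N} :=
  if t is t'.+1 then bad t' :|: [set k | eta < \sum_(j in bad t') adj k j]
  else [set k | C + 1 < \sum_j adj k j] :|:
       \bigcup_(t < T) [set k | eta < mf_gap k t].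

Lemma bad_mono t : bad t \subset bad t.+1.
Proof. exact: finset.subsetUl. Qed.

Lemma bad0_sub t : bad 0 \subset bad t.
Proof. by elim: t => // t /fintype.subset_trans; apply; exact: bad_mono. Qed.

Lemma bad_deg t k : k \notin bad t -> \sum_j adj k j <= C + 1.
Proof.
move=> kt; have : k \notin bad 0.
  by apply: contra kt; exact: (fintype.subsetP (bad0_sub t)).
by rewrite /= !inE negb_or -leNgt => /andP[].
Qed.

Lemma bad_nbr t k : k \notin bad t.+1 -> \sum_(j in bad t) adj k j <= eta.
Proof. by rewrite /= !inE negb_or -leNgt => /andP[]. Qed.

Lemma bad_mf s t k : (t < T)%N -> k \notin bad s -> mf_gap k t <= eta.
Proof.
move=> tT ks; have : k \notin bad 0.
  by apply: contra ks; exact: (fintype.subsetP (bad0_sub s)).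
rewrite /= !inE negb_or => /andP[_]; rewrite leNgt; apply: contra => H.
by apply/bigcupP; exists (Ordinal tT); rewrite ?inE.
Qed.

(** It depends neither on [N] nor on [delta], so [delta] may be chosen after it. *)
Fixpoint bad_const (t : nat) : R :=
  if t is t'.+1 then bad_const t' + (1 + C * bad_const t') / eta
  else 1 + T%:R * (#|X|%:R * 2 / eta).

(** Half of [eta] is spent on the Riemann error; Markov's inequality counts the vertices where the
    graph error exceeds the other half. *)
Lemma card_mf_gap t : (t < T)%N ->
  #|[set k | eta < mf_gap k t]|%:R <= N%:R * delta * (#|X|%:R * 2 / eta).
Proof.
move=> tT.
pose f k := \sum_x
  `|\sum_j adj k j * m j t x - N%:R^-1 * \sum_j w k j * m j t x|.
have f0 k : 0 <= f k by exact: sumr_ge0.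
have fb : \sum_k f k <= #|X|%:R * (N%:R * delta).
  rewrite /f exchange_big mulr_natl -sumr_const; apply: ler_sum => x _.
  apply: close => j; have /andP[? ?] := m01 j x tT; by rewrite ger0_norm.
have := le_trans (card_gt_le (eta / 2) f0) fb.
rewrite -ler_pdivlMl ?divr_gt0// => H; apply: (@le_trans _ _ #|[set k | eta / 2 < f k]|%:R).
  rewrite ler_nat; apply/subset_leq_card/fintype.subsetP => k; rewrite !inE => gk.
  have : mf_gap k t <= f k + eta / 2.
    apply: le_trans (lerD (lexx _) (riemann k tT)); rewrite -big_split.
    by apply: ler_sum => x _; exact: ler_distD.
  by move: gk; lra.
apply: le_trans H _; apply: eq_ler.
by field; rewrite gt_eqF.
Qed.

Lemma card_bad t : #|bad t|%:R <= N%:R * delta * bad_const t.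
Proof.
elim: t => [|t IH].
  apply: (@le_trans _ _ (#|[set k | C + 1 < \sum_j adj k j]|%:R +
      \sum_(t < T) #|[set k | eta < mf_gap k t]|%:R)).
    rewrite -natr_sum -natrD ler_nat; apply: leq_trans (leq_card_setU _ _) _.
    by rewrite leq_add2l card_bigcup_le.
  rewrite /= mulrDr mulr1 lerD//.
    (* For [h = 1] the average of a row of [w] is at most [C], so a normalised degree above [C + 1]
       forces an error above 1, and Markov's inequality applies. *)
    pose f k := `|\sum_j adj k j * 1 - N%:R^-1 * \sum_j w k j * 1|.
    have f0 k : 0 <= f k by exact: normr_ge0.
    have one (j : 'I_N) : `|1 : R| <= 1 by rewrite normr1.
    have := le_trans (card_gt_le 1 f0) (close one).
    rewrite mul1r; apply: le_trans.
    rewrite ler_nat; apply/subset_leq_card/fintype.subsetP => k; rewrite !inE => gk.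
    apply: lt_le_trans (ler_norm _); rewrite ltrBrDr addrC.
    have -> : \sum_j adj k j * 1 = \sum_j adj k j.
      by apply: eq_bigr => j _; rewrite mulr1.
    apply: le_lt_trans gk; rewrite lerD2r mulrC ler_pdivrMr// mulrC -sum_ord_cst.
    by apply: ler_sum => j _; rewrite mulr1 (le_trans (ler_norm _)).
  rewrite mulrCA -[leRHS]sum_ord_cst.
  by apply: ler_sum => t _; exact: card_mf_gap.
apply: (@le_trans _ _ (#|bad t|%:R + #|[set k | eta < \sum_(j in bad t) adj k j]|%:R)).
  by rewrite -natrD ler_nat leq_card_setU.
rewrite /= mulrDr lerD//.
have f0 k : 0 <= \sum_(j in bad t) adj k j.
  by apply: sumr_ge0 => j _; exact: adj_weight_ge0.
have h01 (j : 'I_N) : 0 <= ((j \in bad t)%:R : R) <= 1 by rewrite ler0n lern1 leq_b1.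
have hc : \sum_j (j \in bad t)%:R <= N%:R * delta * bad_const t.
  apply: le_trans IH; rewrite -sum1_card natr_sum [leRHS]big_mkcond.
  by apply: ler_sum => j _; case: ifP.
(* Testing with the indicator of [bad t] bounds the total weight sent into it by
   [N * delta * (1 + C * bad_const t)]; Markov's inequality at level [eta] then counts the new
   vertices. *)
have := sum_row_bound [set: 'I_N] h01 hc; rewrite cardsT card_ord.
have -> : \sum_(k in [set: 'I_N]) \sum_j adj k j * (j \in bad t)%:R =
          \sum_k \sum_(j in bad t) adj k j.
  apply: eq_big => [k|k _]; first by rewrite inE.
  rewrite [RHS]big_mkcond; apply: eq_bigr => j _.
  by case: (j \in bad t); rewrite ?mulr1 ?mulr0.
move=> /(le_trans (card_gt_le eta f0)); rewrite -ler_pdivlMl// => /le_trans; apply.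
apply: eq_ler.
by field; rewrite !gt_eqF.
Qed.

End BadSets.

End DiscreteKernel.

(** * Step functions on the unit interval *)

Section UnitInterval.
Variable R : realType.
Local Notation leb := (@lebesgue_measure R).
Local Open Scope classical_set_scope.

Lemma measurable_unitI : measurable (unitI : set (measurableTypeR R)).
Proof. exact: measurable_itv. Qed.

Lemma integrable_unitI (f : R -> R) (M : R) : measurable_fun unitI f ->
  (forall x, unitI x -> `|f x| <= M) -> leb.-integrable unitI (EFin \o f).
Proof.
move=> mf fM; apply: measurable_bounded_integrable => //.
- exact: measurable_unitI.
- by rewrite /unitI /= lebesgue_measure_itv /= lte_fin ltr01 -EFinB ltry.
- exists M; split; first exact: num_real.
  by move=> y My x Ix; exact: le_trans (fM _ Ix) (ltW My).
Qed.

Lemma Rintegral_itv_bound (a b : R) (f : R -> R) (M e : R) :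
  a <= b -> `]a, b] `<=` unitI -> measurable_fun unitI f ->
  (forall x, unitI x -> `|f x| <= M) -> (forall x, `]a, b] x -> `|f x| <= e) ->
  `|Rintegral leb `]a, b] f| <= e * (b - a).
Proof.
move=> ab sub mf fM fe.
have mab : measurable (`]a, b]%classic : set (measurableTypeR R)) by exact: measurable_itv.
have cab (c : R) : Rintegral leb `]a, b] (fun=> c) = c * (b - a).
  rewrite Rintegral_cst// /= lebesgue_measure_itv /= lte_fin.
  case: ltP => [_|ba] //=.
  by have -> : b - a = 0 by apply/eqP; rewrite subr_eq0 eq_le ba ab.
have intf := integrable_unitI mf fM.
have intfab := integrableS measurable_unitI mab sub intf.
apply: le_trans (le_normr_Rintegral mab intfab) _; rewrite -cab.
apply: le_Rintegral => //.
  exact: integrable_norm intfab.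
apply: (integrableS measurable_unitI mab sub).
exact: (@integrable_unitI _ `|e|).
Qed.

Variable N : nat.
Hypothesis N0 : (0 < N)%N.

Let NR0 : 0 < N%:R :> R. Proof. by rewrite ltr0n. Qed.

Definition grid (j : nat) : R := j%:R / N%:R.

(** Open on the left as in [in_cell]: the right endpoint is the node of agent [j.+1], and the point
    0 lies in no cell. *)
Definition cell (j : nat) : set R := `]grid j, grid j.+1].

Lemma gridS j : grid j.+1 - grid j = N%:R^-1.
Proof. by rewrite /grid -mulrBl -natr1 addrC addKr mul1r. Qed.

Lemma grid_le i j : (i <= j)%N -> grid i <= grid j.
Proof. by move=> ij; rewrite ler_pM2r ?invr_gt0// ler_nat. Qed.

Lemma gridN : grid N = 1.
Proof. by rewrite /grid divff// gt_eqF. Qed.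

Lemma grid0 : grid 0 = 0.
Proof. by rewrite /grid mul0r. Qed.

Lemma grid_unitI j : (j <= N)%N -> unitI (grid j).
Proof.
by move=> jN; rewrite /unitI /= in_itv /= -{1}grid0 -gridN !grid_le.
Qed.

Lemma cell_unitI j : (j < N)%N -> cell j `<=` unitI.
Proof.
move=> jN x; rewrite /cell /unitI /= !in_itv /= => /andP[jx xj].
rewrite (le_trans _ (ltW jx)) ?(le_trans xj)//.
  by rewrite -gridN grid_le.
by rewrite -grid0 grid_le.
Qed.

Lemma cell_uniq i j x : cell i x -> cell j x -> i = j.
Proof.
rewrite /cell /= !in_itv /= => /andP[ix xi] /andP[jx xj].
have lt_grid a b : grid a < grid b.+1 -> (a <= b)%N.
  by rewrite leqNgt; apply: contraTN => ba; rewrite -leNgt grid_le.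
apply/eqP; rewrite eqn_leq.
by rewrite !lt_grid//; [exact: lt_le_trans jx xi | exact: lt_le_trans ix xj].
Qed.

Lemma Rintegral_cells (f : R -> R) (M : R) : measurable_fun unitI f ->
  (forall x, unitI x -> `|f x| <= M) ->
  Rintegral leb unitI f = \sum_(j < N) Rintegral leb (cell j) f.
Proof.
move=> mf fM; have intf := integrable_unitI mf fM.
have sub k : (k <= N)%N -> `]0, grid k]%classic `<=` unitI.
  move=> kN x; rewrite /unitI /= !in_itv /= => /andP[/ltW -> xk].
  by rewrite (le_trans xk)// -gridN grid_le.
have intk k : (k <= N)%N -> leb.-integrable `]0, grid k] (EFin \o f).
  move=> kN; apply: integrableS intf; [exact: measurable_unitI | | exact: sub].
  exact: measurable_itv.
have step k : (k <= N)%N ->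
    Rintegral leb `]0, grid k] f = \sum_(j < k) Rintegral leb (cell j) f.
  elim: k => [_|k IH kN].
    by rewrite big_ord0 grid0 set_itv_ge ?Rintegral_set0// bnd_simp ltxx.
  rewrite big_ord_recr /= -IH ?(ltnW kN)//.
  rewrite -(@Rintegral_itvB _ f (BRight 0) (BRight (grid k.+1)) (grid k)).
  - by rewrite addrC subrK.
  - exact: intk.
  - by rewrite bnd_simp -grid0 grid_le.
  - by rewrite bnd_simp grid_le.
(* The cells leave out the point 0, which does not affect the integral. *)
rewrite -step// gridN /unitI -Rintegral_itv_obnd_cbnd//.
by rewrite -gridN; exact: intk.
Qed.

(** Each cell has its own error, so that the few cells with a discontinuity may carry an error of
    order 1. *)
Lemma step_approx (f : R -> R) (M : R) (c e : 'I_N -> R) :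
  measurable_fun unitI f -> (forall x, unitI x -> `|f x| <= M) ->
  (forall (j : 'I_N) x, cell j x -> `|f x - c j| <= e j) ->
  `|Rintegral leb unitI f - N%:R^-1 * \sum_j c j| <= N%:R^-1 * \sum_j e j.
Proof.
move=> mf fM fc; rewrite (Rintegral_cells mf fM) !big_distrr -sumrB /=.
apply: le_trans (ler_norm_sum _ _ _) _; apply: ler_sum => j _.
have cst (a : R) : Rintegral leb (cell j) (fun=> a) = N%:R^-1 * a.
  rewrite Rintegral_cst; last exact: measurable_itv.
  rewrite /= lebesgue_measure_itv /= lte_fin -subr_gt0 gridS invr_gt0 NR0 /=.
  by rewrite gridS mulrC.
have mcell : measurable (cell j : set (measurableTypeR R)) by exact: measurable_itv.
have cellI := cell_unitI (ltn_ord j).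
have intc (a : R) : leb.-integrable (cell j) (EFin \o (fun=> a)).
  apply: (integrableS measurable_unitI mcell cellI).
  exact: (@integrable_unitI _ `|a|).
have intf := integrableS measurable_unitI mcell cellI (integrable_unitI mf fM).
rewrite -cst -RintegralB//.
have mfc : measurable_fun unitI (fun x => f x - c j).
  exact: measurable_funB.
rewrite -(gridS j) mulrC; apply: (@Rintegral_itv_bound _ _ _ (M + `|c j|)) => //.
- exact: grid_le.
- by move=> x Ix; apply: le_trans (ler_normB _ _) _; rewrite lerD2r fM.
- by move=> x; exact: fc.
Qed.

Definition stepf (v : 'I_N -> R) (x : R) : R := \sum_j v j * \1_(cell j) x.

Lemma measurable_stepf (v : 'I_N -> R) : measurable_fun unitI (stepf v).
Proof.
apply: measurable_sum => j; apply: measurable_funM => //.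
apply: measurable_indic; exact: measurable_itv.
Qed.

Lemma stepfE (v : 'I_N -> R) (j : 'I_N) x : cell j x -> stepf v x = v j.
Proof.
move=> jx; rewrite /stepf (bigD1 j)//= indicE mem_set// mulr1 big1 ?addr0// => i ij.
rewrite indicE memNset ?mulr0// => ix.
by move/negP: ij; apply; apply/eqP/val_inj; exact: cell_uniq ix jx.
Qed.

Lemma stepf_out (v : 'I_N -> R) x : (forall j : 'I_N, ~ cell j x) -> stepf v x = 0.
Proof. by move=> xN; rewrite /stepf big1// => j _; rewrite indicE memNset ?mulr0. Qed.

Lemma stepf_le (v : 'I_N -> R) (M : R) x : 0 <= M -> (forall j, `|v j| <= M) ->
  `|stepf v x| <= M.
Proof.
move=> M0 vM; have [[j jx]|xN] := pselect (exists j : 'I_N, cell j x).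
  by rewrite (stepfE v jx).
by rewrite stepf_out ?normr0// => j jx; apply: xN; exists j.
Qed.

Lemma Rintegral_stepf (v : 'I_N -> R) :
  Rintegral leb unitI (stepf v) = N%:R^-1 * \sum_j v j.
Proof.
have vM j : `|v j| <= \sum_i `|v i| by rewrite (bigD1 j)//= lerDl sumr_ge0.
apply/eqP; rewrite -subr_eq0 -normr_le0.
have M0 : 0 <= \sum_i `|v i| by exact: sumr_ge0.
apply: le_trans (step_approx (measurable_stepf v)
  (fun x _ => stepf_le x M0 vM) (e := fun=> 0) _) _.
  by move=> j x jx; rewrite (stepfE v jx) subrr normr0.
by rewrite big1 ?mulr0.
Qed.

End UnitInterval.

(** * Piecewise Lipschitz functions *)

Section PiecewiseLipschitz.
Variable R : realType.
Implicit Types (f : R -> R) (D : seq R).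

Definition lip_off D (L : R) f : Prop := forall a b, unitI a -> unitI b ->
  (forall d, d \in D -> ~ (Num.min a b <= d <= Num.max a b)%R) ->
  `|f a - f b| <= L * `|a - b|.

Definition pw_lip f : Prop := exists D L M,
  [/\ 0 <= L, lip_off D L f & forall a, unitI a -> `|f a| <= M].

Lemma lip_offW D D' L L' f : {subset D <= D'} -> L <= L' ->
  lip_off D L f -> lip_off D' L' f.
Proof.
move=> DD LL fL a b Ia Ib sep.
apply: le_trans (fL a b Ia Ib _) _; first by move=> d /DD/sep.
by rewrite ler_wpM2r.
Qed.

Lemma lip_off_common (I : eqType) (e : seq I) (F : I -> R -> R) :
  (forall i, i \in e -> pw_lip (F i)) ->
  exists D L, 0 <= L /\ forall i, i \in e -> lip_off D L (F i).
Proof.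
elim: e => [|i e IH] Fe; first by exists [::], 0.
have [|D [L [L0 FL]]] := IH; first by move=> j je; apply: Fe; rewrite in_cons je orbT.
have [|D' [L' [M [L'0 fL' _]]]] := Fe i; first exact: mem_head.
exists (D' ++ D), (L' + L); split=> [|j]; first exact: addr_ge0.
rewrite in_cons => /predU1P[->|je].
  by apply: lip_offW fL' => [d dD|]; rewrite ?mem_cat ?dD// lerDl.
by apply: lip_offW (FL j je) => [d dD|]; rewrite ?mem_cat ?dD ?orbT// lerDr.
Qed.

(** The exceptional points of finitely many functions can be merged into one list. Sums, products
    and Lipschitz functions of finitely many regular functions all reduce to this domination. *)
Lemma pw_lip_dom (I : finType) (F : I -> R -> R) f (L M : R) :
  0 <= L -> (forall i, pw_lip (F i)) -> (forall a, unitI a -> `|f a| <= M) ->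
  (forall a b, unitI a -> unitI b ->
     `|f a - f b| <= L * \sum_i `|F i a - F i b|) ->
  pw_lip f.
Proof.
move=> L0 FL fM fF.
have [|D [K [K0 FK]]] := @lip_off_common I (enum I) F; first by move=> i _.
exists D, (L * (#|I|%:R * K)), M; split=> //; first by rewrite !mulr_ge0.
move=> a b Ia Ib sep; apply: le_trans (fF a b Ia Ib) _.
rewrite -!mulrA ler_wpM2l// mulr_natl -sumr_const; apply: ler_sum => i _.
by apply: FK => //; rewrite mem_enum.
Qed.

Lemma eq_pw_lip f f' : (forall a, unitI a -> f a = f' a) -> pw_lip f -> pw_lip f'.
Proof.
move=> ff [D [L [M [L0 fL fM]]]]; exists D, L, M; split=> // [a b Ia Ib|a Ia].
  by rewrite -!ff//; exact: fL.
by rewrite -ff// fM.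
Qed.

Lemma pw_lip_cst (c : R) : pw_lip (fun=> c).
Proof.
exists [::], 0, `|c|; split=> // a b _ _ _.
by rewrite subrr normr0 mul0r.
Qed.

Lemma pw_lip_sum (I : finType) (F : I -> R -> R) :
  (forall i, pw_lip (F i)) -> pw_lip (fun a => \sum_i F i a).
Proof.
move=> FL; have [|M FM] := @choice I R (fun i M => forall a, unitI a -> `|F i a| <= M).
  by move=> i; have [D [L [M [_ _ ?]]]] := FL i; exists M.
apply: (@pw_lip_dom I F _ 1 (\sum_i M i)) => // [a Ia|a b _ _].
  by apply: le_trans (ler_norm_sum _ _ _) _; apply: ler_sum => i _; exact: FM.
by rewrite mul1r -sumrB ler_norm_sum.
Qed.

Lemma pw_lipM f g : pw_lip f -> pw_lip g -> pw_lip (fun a => f a * g a).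
Proof.
move=> fL gL; have [D [L [M [_ _ fM]]]] := fL; have [D' [L' [M' [_ _ gM]]]] := gL.
have I0 : unitI (0 : R) by rewrite /unitI /= in_itv /= lexx ler01.
have M0 : 0 <= M by exact: le_trans (fM 0 I0).
have M'0 : 0 <= M' by exact: le_trans (gM 0 I0).
apply: (@pw_lip_dom bool (fun i => if i then f else g) _ (M + M') (M * M')).
- exact: addr_ge0.
- by case.
- by move=> a Ia; rewrite normrM ler_pM// ?fM ?gM.
move=> a b Ia Ib; rewrite big_bool /=.
have -> : f a * g a - f b * g b = (f a - f b) * g a + f b * (g a - g b) by ring.
apply: le_trans (ler_normD _ _) _; rewrite !normrM.
have h1 : `|f a - f b| * `|g a| <= M' * `|f a - f b|.
  by rewrite mulrC ler_wpM2r// gM.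
have h2 : `|f b| * `|g a - g b| <= M * `|g a - g b| by rewrite ler_wpM2r// fM.
apply: le_trans (lerD h1 h2) _; rewrite mulrDr !mulrDl.
have := mulr_ge0 M0 (normr_ge0 (f a - f b)).
have := mulr_ge0 M'0 (normr_ge0 (g a - g b)).
by lra.
Qed.

Lemma lipschitz_except_finite_pw_lip f (M : R) :
  lipschitz_except_finite f -> (forall a, unitI a -> `|f a| <= M) -> pw_lip f.
Proof.
move=> [D [L fL]] fM; exists D, `|L|, M; split=> // a b Ia Ib sep.
by apply: le_trans (fL a b Ia Ib sep) _; rewrite ler_wpM2r// ler_norm.
Qed.

(** * Riemann sums of piecewise Lipschitz functions *)

Section Riemann.
Variables (N : nat) (N0 : (0 < N)%N) (D : seq R).

Definition bad_cell (j : 'I_N) : bool := has (in_cell j) D.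

Lemma in_cellP (j : 'I_N) x : @cell R N j x <-> in_cell j x.
Proof. by rewrite /cell /grid /in_cell /= in_itv. Qed.

(** The cells are disjoint, so each exceptional point spoils at most one of them. *)
Lemma sum_bad_cell : \sum_j (bad_cell j)%:R <= (size D)%:R :> R.
Proof.
apply: (@le_trans _ _ (\sum_(j < N) \sum_(d <- D) (in_cell j d)%:R)).
  apply: ler_sum => j _; rewrite /bad_cell; elim: D => [|d e IH] /=.
    by rewrite big_nil.
  rewrite big_cons; case: (in_cell j d) => /=; last by rewrite add0r.
  by rewrite lerDl sumr_ge0.
rewrite exchange_big -sum1_size natr_sum; apply: ler_sum => d _ /=.
have [[j jd]|xN] := pselect (exists j : 'I_N, in_cell j d); last first.
  rewrite big1// => j _; case: (boolP (in_cell j d)) => // jd.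
  by case: xN; exists j.
rewrite (bigD1 j)//= jd big1 ?addr0// => i ij.
case: (boolP (in_cell i d)) => // id; case/negP: ij; apply/eqP/val_inj.
by apply: (cell_uniq N0 (x := d)); exact/in_cellP.
Qed.

Lemma cell_osc f (L M : R) (j : 'I_N) x : 0 <= L -> lip_off D L f ->
  (forall a, unitI a -> `|f a| <= M) -> @cell R N j x ->
  `|f x - f (@grid R N j.+1)| <= L / N%:R + 2 * M * (bad_cell j)%:R.
Proof.
move=> L0 fL fM jx; have Ix := cell_unitI N0 (ltn_ord j) jx.
have Ij : unitI (@grid R N j.+1) by exact: grid_unitI.
have NV0 : 0 < N%:R^-1 :> R by rewrite invr_gt0 ltr0n.
have [bad|good] := boolP (bad_cell j); rewrite ?mulr1 ?mulr0 ?addr0.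
  apply: le_trans (ler_normB _ _) _.
  by move: (fM _ Ix) (fM _ Ij) (mulr_ge0 L0 (ltW NV0)); lra.
move: (jx); rewrite /cell /= in_itv /= => /andP[gx xg].
apply: le_trans (fL _ _ Ix Ij _) _.
  move=> d dD; rewrite min_l// max_r// => /andP[xd dg].
  move/hasP: good; apply; exists d => //.
  by apply/andP; split; [exact: lt_le_trans gx xd | exact: dg].
rewrite ler_wpM2l// distrC ger0_norm ?subr_ge0// -(@gridS R N j).
by rewrite lerD2l lerN2 ltW.
Qed.

(** A good cell oscillates by at most [L / N%:R]; at most [size D] cells are bad, and each costs
    [2 * M]. *)
Lemma riemann_sum f (L M : R) : measurable_fun unitI f -> 0 <= L -> lip_off D L f ->
  (forall a, unitI a -> `|f a| <= M) ->
  `|Rintegral (@lebesgue_measure R) unitI f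
    - N%:R^-1 * \sum_(j < N) f (@grid R N j.+1)|
  <= N%:R^-1 * (L + 2 * M * (size D)%:R).
Proof.
move=> mf L0 fL fM; apply: le_trans (step_approx N0 mf fM
  (fun j x => @cell_osc f L M j x L0 fL fM)) _.
have NR0 : 0 < N%:R :> R by rewrite ltr0n.
rewrite ler_wpM2l ?invr_ge0 ?(ltW NR0)// big_split /= sum_ord_cst mulrC.
rewrite divfK ?gt_eqF// lerD2l -big_distrr /= ler_wpM2l ?sum_bad_cell//.
rewrite mulr_ge0//; apply: le_trans (fM 0 _) => //.
by rewrite /unitI /= in_itv /= lexx ler01.
Qed.

End Riemann.

Lemma Rintegral_unitI_bound f (e : R) : measurable_fun unitI f ->
  (forall x, unitI x -> `|f x| <= e) ->
  `|Rintegral (@lebesgue_measure R) unitI f| <= e.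
Proof.
(* A partition into a single cell, with approximating constant 0. *)
move=> mf fe; have := @step_approx R 1 isT f e (fun=> 0) (fun=> e) mf fe _.
rewrite !big_ord1 mulr0 subr0 invr1 mul1r; apply => j x jx; rewrite subr0.
by apply: fe; exact: (@cell_unitI R 1 isT j (ltn_ord j)).
Qed.

End PiecewiseLipschitz.

(** * Uniform regularity of the graphon *)

Section GraphonRegularity.
Variable R : realType.
Implicit Type W : R -> R -> R.

Definition itv_ends (i : interval R) : seq R :=
  let: Interval l u := i in
  (if l is BSide _ a then [:: a] else [::]) ++ (if u is BSide _ a then [:: a] else [::]).

(** Leaving an interval means crossing one of its finite endpoints. *)
Lemma itv_sep (i : interval R) (x y : R) : x \in i ->
  (forall d, d \in itv_ends i -> ~ (Num.min x y <= d <= Num.max x y)%R) ->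
  y \in i.
Proof.
case: i => l u; rewrite !itv_boundlr /= => /andP[lx xu] sep.
have key d : d \in itv_ends (Interval l u) ->
    (d < x /\ d < y) \/ (x < d /\ y < d).
  move=> /sep/negP; rewrite negb_and -!ltNge lt_min gt_max.
  by case/orP => /andP[]; [left | right].
apply/andP; split.
  case: l lx sep key => [[] a|[]]//; rewrite !bnd_simp => ax _ /(_ a).
    by rewrite mem_head => /(_ isT); lra.
  by rewrite mem_head => /(_ isT); lra.
case: u xu sep key => [[] a|[]]//; rewrite !bnd_simp => xa _ /(_ a).
  by rewrite /= mem_cat mem_head orbT => /(_ isT); lra.
by rewrite /= mem_cat mem_head orbT => /(_ isT); lra.
Qed.

(** The common consequence of both alternatives of (A2): one finite set of exceptional points for
    all sections, and a uniform bound. *)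
Lemma graphon_regular W :
  ((exists L : R, forall x y x' y', unitI x -> unitI y -> unitI x' ->
      unitI y' -> `|W x y - W x' y'| <= L * (`|x - x'| + `|y - y'|))
   \/
   (exists (LW : R) (Q : nat) (Iq : 'I_Q -> interval R),
      [/\ 0 < LW,
          (forall i j z, z \in Iq i -> z \in Iq j -> i = j),
          (forall z, unitI z -> exists i, z \in Iq i)
        & (forall i j x y x' y', unitI x -> unitI y -> unitI x' -> unitI y' ->
             x \in Iq i -> x' \in Iq i -> y \in Iq j -> y' \in Iq j ->
             `|W x y - W x' y'| <= LW * (`|x - x'| + `|y - y'|))])) ->
  exists (D : seq R) (L C : R), [/\ 0 <= L, 0 <= C,
    (forall y, unitI y -> lip_off D L (fun x => W x y)) &
    (forall x y, unitI x -> unitI y -> `|W x y| <= C)].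
Proof.
have dist1 (x y : R) : unitI x -> unitI y -> `|x - y| <= 1.
  rewrite /unitI /= !in_itv /= => /andP[x0 x1] /andP[y0 y1].
  by rewrite ler_norml; apply/andP; split; lra.
case=> [[L WL]|[L [Q [Iq [L0 Iinj Icov WL]]]]].
  have I0 : unitI (0 : R) by rewrite /unitI /= in_itv /= lexx ler01.
  exists [::], `|L|, (`|W 0 0| + `|L| * 2); split=> //.
  - move=> y Iy x x' Ix Ix' _; apply: le_trans (WL _ _ _ _ Ix Iy Ix' Iy) _.
    by rewrite subrr normr0 addr0 ler_wpM2r// ler_norm.
  - move=> x y Ix Iy; rewrite -[W x y](subrK (W 0 0)) addrC.
    apply: le_trans (ler_normD _ _) _; rewrite lerD2l.
    apply: le_trans (WL _ _ _ _ Ix Iy I0 I0) _.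
    apply: (@le_trans _ _ (`|L| * (`|x - 0| + `|y - 0|))).
      by rewrite ler_wpM2r ?addr_ge0// ler_norm.
    by rewrite ler_wpM2l// -[2]/(1 + 1) lerD// dist1.
(* A point of each piece inside the unit interval, used to bound [W]; the default 0 arises only for
   pieces that miss the unit interval, and these are never visited. *)
pose rep i := xget 0 [set z : R | unitI z /\ z \in Iq i]%classic.
have repP i z : unitI z -> z \in Iq i -> unitI (rep i) /\ rep i \in Iq i.
  by move=> Iz zi; rewrite /rep; case: xgetP => [_ -> []//|/(_ z)] /= [].
exists (flatten [seq itv_ends (Iq i) | i <- enum 'I_Q]), L,
  (\sum_i \sum_j `|W (rep i) (rep j)| + L * 2); split; first exact: ltW.
- by rewrite addr_ge0 ?mulr_ge0 ?(ltW L0)//; do 2!apply: sumr_ge0 => ? _.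
- move=> y Iy x x' Ix Ix' sep.
  have [i xi] := Icov x Ix; have [j yj] := Icov y Iy.
  have x'i : x' \in Iq i.
    apply: (itv_sep xi) => d dI; apply: sep; apply/flattenP.
    by exists (itv_ends (Iq i)) => //; apply/mapP; exists i; rewrite ?mem_enum.
  have := WL _ _ _ _ _ _ Ix Iy Ix' Iy xi x'i yj yj.
  by rewrite subrr normr0 addr0.
- move=> x y Ix Iy; have [i xi] := Icov x Ix; have [j yj] := Icov y Iy.
  have [Ir ri] := repP i x Ix xi; have [Is sj] := repP j y Iy yj.
  rewrite -[W x y](subrK (W (rep i) (rep j))) addrC.
  apply: le_trans (ler_normD _ _) _; apply: lerD.
    by rewrite (bigD1 i)//= (bigD1 j)//= -addrA lerDl addr_ge0//;
       repeat (apply: sumr_ge0 => ? _).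
  apply: le_trans (WL _ _ _ _ _ _ Ix Iy Ir Is xi ri yj sj) _.
  by rewrite ler_pM2l// -[2]/(1 + 1) lerD// dist1.
Qed.

Lemma measurable_section W a : is_graphon W -> unitI a -> measurable_fun unitI (W a).
Proof.
case=> _ _ mW _ Ia.
apply: (@measurable_comp _ _ _ _ _ _ (unitI `*` unitI)%classic
  (fun z : R * R => W z.1 z.2) _ (fun b => (a, b))) => //.
- by apply: measurableX; exact: measurable_itv.
- by move=> _ [b Ib <-].
- apply: (measurable_funS measurableT) => //; exact: pair1_measurable.
Qed.

End GraphonRegularity.

(** * Discretization of the graphon distance *)

Section Discretization.
Variable R : realType.
Local Notation leb := (@lebesgue_measure R).

(* Unlike [ge0_le_integral], no measurability is needed: the integral of a
   nonnegative function is a supremum over the simple functions below it. *)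
Lemma ge0_le_integral_nomeas d (S : measurableType d) (nu : {measure set S -> \bar R})
    (A : set S) (f g : S -> \bar R) :
  (forall x, A x -> 0 <= f x)%E -> (forall x, A x -> f x <= g x)%E ->
  (\int[nu]_(x in A) f x <= \int[nu]_(x in A) g x)%E.
Proof.
move=> f0 fg; rewrite integral_mkcond [leRHS]integral_mkcond.
have f0' x : (0 <= (f \_ A)%function x)%E by exact: erestrict_ge0.
have fg' x : ((f \_ A)%function x <= (g \_ A)%function x)%E.
  by rewrite !patchE; case: ifPn => // /set_mem; exact: fg.
rewrite !ge0_integralTE//; last by move=> x; exact: le_trans (f0' x) (fg' x).
apply: le_ereal_sup => _ [h hf <-]; exists h => // x.
exact: le_trans (hf x) (fg' x).
Qed.

Lemma integral_unitI_fin (f : R -> R) (M : R) : measurable_fun unitI f ->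
  (forall x, unitI x -> `|f x| <= M) ->
  (\int[leb]_(x in unitI) (f x)%:E)%E = (Rintegral leb unitI f)%:E.
Proof.
move=> mf fM; rewrite /Rintegral fineK//.
apply: integrable_fin_num; [exact: measurable_unitI | exact: integrable_unitI mf fM].
Qed.

Variables (W : R -> R -> R) (D : seq R) (L C : R).
Hypotheses (Wg : is_graphon W) (L0 : 0 <= L) (C0 : 0 <= C).
Hypothesis Wlip : forall y, unitI y -> lip_off D L (fun x => W x y).
Hypothesis WC : forall x y, unitI x -> unitI y -> `|W x y| <= C.

Lemma Wlip2 x : unitI x -> lip_off D L (W x).
Proof.
move=> Ix a b Ia Ib sep; case: Wg => _ Wsym _ _.
by rewrite (Wsym x a)// (Wsym x b)//; exact: Wlip.
Qed.

Section Cells.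
Variables (N : nat) (E : 'I_N -> 'I_N -> bool) (rho : R).
Hypotheses (N0 : (0 < N)%N) (rho0 : 0 < rho).

Local Notation node j := (@grid R N j.+1).

Let NR0 : 0 < N%:R :> R. Proof. by rewrite ltr0n. Qed.

(** The error at vertex [k] between the graph operator and the sampled graphon operator, as in the
    hypothesis [close] on discrete kernels. *)
Definition graphon_gap (h : 'I_N -> R) (k : 'I_N) : R :=
  \sum_j adj_weight E rho k j * h j
  - N%:R^-1 * \sum_(j < N) W (node k) (node j) * h j.

(** The first two terms pay for moving the row variable to the node of [k], the last for the Riemann
    sum in the column variable. *)
Let osc (k : 'I_N) : R :=
  L / N%:R + 2 * C * (bad_cell D k)%:R + N%:R^-1 * (L + 2 * C * (size D)%:R).

Lemma step_graphonE (k : 'I_N) (a b : R) : cell N k a ->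
  step_graphon E a b = stepf (fun j => (E k j)%:R) b.
Proof.
move=> ka; rewrite /step_graphon.
have cellk i : in_cell i a -> i = k.
  by move=> /in_cellP ia; apply/val_inj/(cell_uniq N0 ia ka).
have [[j jb]|bN] := pselect (exists j : 'I_N, cell N j b).
  rewrite (stepfE N0 _ jb); case: (boolP (E k j)) => Ekj.
    suff -> : [exists i, exists j, [&& in_cell i a, in_cell j b & E i j]] by [].
    by apply/existsP; exists k; apply/existsP; exists j; apply/and3P; split;
       [apply/in_cellP|apply/in_cellP|].
  case: existsP => // -[i /existsP[l /and3P[/cellk -> /in_cellP lb Ekl]]].
  by case/negP: Ekj; rewrite -(val_inj (cell_uniq N0 lb jb)).
rewrite stepf_out; last by move=> j jb; apply: bN; exists j.
case: existsP => // -[i /existsP[l /and3P[_ /in_cellP lb _]]].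
by case: bN; exists l.
Qed.

Lemma integral_row_approx (h : 'I_N -> R) (k : 'I_N) (a : R) :
  (forall j, `|h j| <= 1) -> cell N k a ->
  exists2 z : R, (\int[leb]_(b in unitI)
      ((rho^-1 * step_graphon E a b - W a b) * stepf h b)%:E)%E = z%:E
    & `|z - graphon_gap h k| <= osc k.
Proof.
move=> h1 ka; have Ia := cell_unitI N0 (ltn_ord k) ka.
pose F b := (rho^-1 * stepf (fun j => (E k j)%:R) b - W a b) * stepf h b.
have mF : measurable_fun unitI F.
  apply: measurable_funM; last exact: measurable_stepf.
  apply: measurable_funB; last exact: measurable_section.
  by apply: measurable_funM => //; exact: measurable_stepf.
have FM b : unitI b -> `|F b| <= rho^-1 + C.
  move=> Ib; rewrite normrM -[leRHS]mulr1 ler_pM//; last exact: stepf_le.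
  apply: le_trans (ler_normB _ _) _; rewrite lerD ?WC// normrM.
  rewrite gtr0_norm ?invr_gt0// -[leRHS]mulr1 ler_wpM2l ?invr_ge0 ?(ltW rho0)//.
  by apply: stepf_le => // j; rewrite normr_nat lern1 leq_b1.
exists (Rintegral leb unitI F).
  rewrite -(integral_unitI_fin mF FM); apply: eq_integral => b _.
  by rewrite /F (step_graphonE _ ka).
pose c j := (rho^-1 * (E k j)%:R - W (node k) (node j)) * h j.
pose e (j : 'I_N) := (L / N%:R + 2 * C * (bad_cell D k)%:R) +
                     (L / N%:R + 2 * C * (bad_cell D j)%:R).
have Fc (j : 'I_N) b : cell N j b -> `|F b - c j| <= e j.
  move=> jb; have Ib := cell_unitI N0 (ltn_ord j) jb.
  have Ik : unitI (node k) by exact: grid_unitI.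
  rewrite /F /c !(stepfE N0 _ jb) -mulrBl normrM.
  rewrite -[leRHS]mulr1 ler_pM// opprB addrC subrKA distrC.
  apply: le_trans (ler_distD (W (node k) b) _ _) _; apply: lerD.
    exact: (cell_osc N0 L0 (Wlip Ib) (fun x Ix => WC Ix Ib) ka).
  exact: (cell_osc N0 L0 (Wlip2 Ik) (fun y Iy => WC Ik Iy) jb).
have -> : graphon_gap h k = N%:R^-1 * \sum_j c j.
  rewrite /graphon_gap !big_distrr -sumrB; apply: eq_bigr => j _ /=.
  by rewrite /c /adj_weight; field; rewrite !gt_eqF.
apply: le_trans (step_approx N0 mF FM Fc) _.
rewrite big_split /= sum_ord_cst mulrDr mulKf ?gt_eqF// lerD2l.
rewrite ler_wpM2l ?invr_ge0 ?(ltW NR0)// big_split /= sum_ord_cst.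
rewrite [_ * (L / _)]mulrC divfK ?gt_eqF// lerD2l -big_distrr /= ler_wpM2l ?sum_bad_cell//.
exact: mulr_ge0.
Qed.

(** The step function of [h] is admissible in the norm, and on cell [k] its row integral is
    [graphon_gap h k] up to [osc k]. Summing [osc] over [k] gives the constant, since the number of
    bad cells is bounded. *)
Lemma linf_l1_lower (h : 'I_N -> R) : (forall j, `|h j| <= 1) ->
  ((N%:R^-1 * (\sum_k `|graphon_gap h k|
      - (2 * L + 4 * C * (size D)%:R)))%:E <=
   linf_l1_norm (fun x y => rho^-1 * step_graphon E x y - W x y)%R)%E.
Proof.
move=> h1; apply: (@le_trans _ _ (\int[leb]_(a in unitI)
    `| \int[leb]_(b in unitI)
       ((rho^-1 * step_graphon E a b - W a b) * stepf h b)%:E |)%E); last first.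
  apply: ereal_sup_ubound; exists (stepf h); split=> //.
    exact: measurable_stepf.
  by move=> b _; exact: stepf_le.
(* Truncation at 0 makes [stepf v] a nonnegative minorant of the outer integrand, also at the point
   0, which lies in no cell. *)
pose v k := Num.max 0 (`|graphon_gap h k| - osc k).
have v0 k : 0 <= v k by rewrite le_max lexx.
have vM k : `|v k| <= \sum_i v i.
  by rewrite ger0_norm// (bigD1 k)//= lerDl sumr_ge0.
have M0 : 0 <= \sum_i v i by exact: sumr_ge0.
apply: (@le_trans _ _ (\int[leb]_(a in unitI) (stepf v a)%:E)%E).
  rewrite (integral_unitI_fin (measurable_stepf v) (fun x _ => stepf_le N0 x M0 vM)).
  rewrite Rintegral_stepf// lee_fin ler_wpM2l ?invr_ge0 ?(ltW NR0)//.
  apply: (@le_trans _ _ (\sum_k (`|graphon_gap h k| - osc k))); last first.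
    by apply: ler_sum => k _; rewrite le_max lexx orbT.
  rewrite sumrB lerD2l lerN2 !big_split /= !sum_ord_cst -big_distrr /=.
  rewrite mulVKf ?gt_eqF// [_ * (L / _)]mulrC divfK ?gt_eqF//.
  have := ler_wpM2l (mulr_ge0 (ler0n R 2) C0) (sum_bad_cell N0 D).
  by lra.
apply: ge0_le_integral_nomeas => a Ia.
  rewrite lee_fin; have [[k ka]|aN] := pselect (exists k : 'I_N, cell N k a).
    by rewrite (stepfE N0 _ ka).
  by rewrite stepf_out// => k ka; apply: aN; exists k.
have [[k ka]|aN] := pselect (exists k : 'I_N, cell N k a); last first.
  by rewrite stepf_out ?abse_ge0// => k ka; apply: aN; exists k.
have [z -> zc] := integral_row_approx h1 ka.
rewrite (stepfE N0 _ ka) /= lee_fin ge_max normr_ge0 /=.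
rewrite lerBlDr -lerBlDl; apply: le_trans zc; rewrite [leRHS]distrC.
exact: lerB_dist.
Qed.

End Cells.

(** The norm is a supremum over test functions, so one threshold serves every [h]: half of [delta]
    covers the norm, the other half the discretisation error [K / N]. *)
Lemma graphon_gap_small (E : forall N, 'I_N -> 'I_N -> bool) (rho : nat -> R) :
  (forall N, 0 < rho N) -> assumption_A1 W E rho ->
  forall delta : R, 0 < delta -> exists N0 : nat, forall N, (N0 < N)%N ->
    forall h : 'I_N -> R, (forall j, `|h j| <= 1) ->
    \sum_k `|graphon_gap (E N) (rho N) h k| <= N%:R * delta.
Proof.
move=> rho0 [_ cv] delta delta0.
have : (\forall N \near \oo%classic, linf_l1_norm (fun x y =>
    (rho N)^-1 * step_graphon (E N) x y - W x y)%R < (delta / 2)%:E)%E.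
  apply: (cv [set y | (y < (delta / 2)%:E)%E]%classic).
  exists (delta / 2); first by rewrite /= divr_gt0.
  move=> y /= yd; rewrite lte_fin.
  by move: yd; rewrite sub0r normrN; exact: le_lt_trans (ler_norm _).
case=> n1 _ n1P.
pose K := 2 * L + 4 * C * (size D)%:R.
have K0 : 0 <= K by rewrite addr_ge0// !mulr_ge0.
pose n2 := Num.truncn (2 * K / delta).
exists (maxn n1 n2) => N; rewrite gtn_max => /andP[n1N n2N] h h1.
have N0 : (0 < N)%N by exact: leq_ltn_trans n1N.
have NR0 : 0 < N%:R :> R by rewrite ltr0n.
have := le_lt_trans (linf_l1_lower (E N) N0 (rho0 N) h1) (n1P N (ltnW n1N)).
rewrite lte_fin mulrC ltr_pdivrMr// -/K => H.
have : 2 * K / delta < N%:R.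
  apply: lt_le_trans (truncnS_gt _) _; by rewrite ler_nat.
rewrite ltr_pdivrMr// => H2.
by move: H H2; lra.
Qed.

End Discretization.

(** * Regularity of the mean field *)

Section MeanFieldRegularity.
Variables (R : realType) (X U : finType) (T : nat).
Variables (mu0 : X -> R) (P : X -> U -> (X -> R) -> X -> R).
Variables (r : X -> U -> (X -> R) -> R) (W : R -> R -> R).
Variables (pi : R -> nat -> X -> U -> R) (mu : R -> nat -> X -> R).
Hypotheses (Pok : kernel_ok P) (Wg : is_graphon W).
Hypothesis gmfe : is_GMFE T W P r mu0 pi mu.
Variables (D : seq R) (L C Lp : R).
Hypotheses (L0 : 0 <= L) (C0 : 0 <= C) (Lp0 : 0 <= Lp).
Hypothesis Wlip : forall y, unitI y -> lip_off D L (fun x => W x y).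
Hypothesis WC : forall x y, unitI x -> unitI y -> `|W x y| <= C.
Hypothesis Plip : forall x u nu nu', is_bmeas nu -> is_bmeas nu' ->
  l1 (fun y => P x u nu y - P x u nu' y) <= Lp * l1 (fun y => nu y - nu' y).
Hypothesis pi_lip : forall t x u, lipschitz_except_finite (fun a => pi a t x u).

Local Notation leb := (@lebesgue_measure R).

Lemma is_prob_le1 (S : finType) (p : S -> R) x : is_prob p -> `|p x| <= 1.
Proof.
move=> [p0 p1]; rewrite ger0_norm// -p1 (bigD1 x)//= lerDl.
by apply: sumr_ge0 => y _.
Qed.

Lemma gmfe_policy a : unitI a -> is_policy T (pi a).
Proof. by case: gmfe => -[piP _] _ _ _; exact: piP. Qed.

Lemma gmfe_prob a t : unitI a -> (t < T)%N -> is_prob (mu a t).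
Proof. by case: gmfe => _ [muP _] _ _; exact: muP. Qed.

Lemma gmfe_measurable t x : measurable_fun unitI (fun a => mu a t x).
Proof. by case: gmfe => _ [_ muM] _ _. Qed.

Lemma gmfe_init a x : unitI a -> (0 < T)%N -> mu a 0%N x = mu0 x.
Proof. by case: gmfe => _ _ muE _ Ia T0; rewrite muE. Qed.

Lemma gmfe_step a t x : unitI a -> (t.+1 < T)%N ->
  mu a t.+1 x =
  expect (mu a t) (fun x' => agent_kernel P (pi a t) (Gop W mu a t) x' x).
Proof.
move=> Ia tT; case: gmfe => _ _ muE _; rewrite muE// /Psi /=.
(* The equilibrium identifies [mu] with [Psi] only on the unit interval and before [T]; this is
   enough under the integral. *)
have -> : (fun y => Rintegral leb unitI
    (fun b => W a b * psi_rec W P mu0 pi t b y)) = Gop W mu a t.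
  apply/funext => y; apply: eq_Rintegral => b /set_mem Ib.
  by rewrite muE// ltnW.
by apply: eq_bigr => x' _; rewrite muE// ltnW.
Qed.

Lemma Gop_integrand_measurable a t x : unitI a ->
  measurable_fun unitI (fun b => W a b * mu b t x).
Proof.
by move=> Ia; apply: measurable_funM; [exact: measurable_section | exact: gmfe_measurable].
Qed.

Lemma Gop_integrand_le a b t x : unitI a -> unitI b -> (t < T)%N ->
  `|W a b * mu b t x| <= C.
Proof.
move=> Ia Ib tT; rewrite normrM -[leRHS]mulr1 ler_pM// ?WC//.
exact: is_prob_le1 (gmfe_prob Ib tT).
Qed.

Lemma Gop_bmeas a t : unitI a -> (t < T)%N -> is_bmeas (Gop W mu a t).
Proof.
move=> Ia tT x; apply: Rintegral_ge0 => b Ib.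
by case: Wg => W0 _ _ _; rewrite mulr_ge0 ?W0//; case: (gmfe_prob Ib tT).
Qed.

Lemma Gop_le a t x : unitI a -> (t < T)%N -> `|Gop W mu a t x| <= C.
Proof.
move=> Ia tT; apply: Rintegral_unitI_bound; first exact: Gop_integrand_measurable.
by move=> b Ib; exact: Gop_integrand_le.
Qed.

(** Integrating over the second variable preserves the regularity of [W] in the first because [D]
    and [L] do not depend on the second. *)
Lemma Gop_pw_lip t x : (t < T)%N -> pw_lip (fun a => Gop W mu a t x).
Proof.
move=> tT; exists D, L, C; split=> // [a b Ia Ib sep|a Ia]; last exact: Gop_le.
have int c (Ic : unitI c) := integrable_unitI (Gop_integrand_measurable t x Ic)
  (fun b Ib => Gop_integrand_le x Ic Ib tT).
rewrite /Gop -RintegralB//; [|exact: measurable_unitI|exact: int|exact: int].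
apply: Rintegral_unitI_bound.
  by apply: measurable_funB; exact: Gop_integrand_measurable.
move=> y Iy; rewrite -mulrBl normrM -[leRHS]mulr1 ler_pM//.
  exact: Wlip.
exact: is_prob_le1 (gmfe_prob Iy tT).
Qed.

(** By induction on time: one step of the mean field is a finite sum of products of the previous
    law, the policy and the kernel, and the kernel is Lipschitz in the regular field. *)
Lemma gmfe_pw_lip t x : (t < T)%N -> pw_lip (fun a => mu a t x).
Proof.
elim: t x => [|t IH] x tT.
  by apply: eq_pw_lip (pw_lip_cst (mu0 x)) => a Ia; rewrite gmfe_init.
have tT' := ltnW tT.
apply: (@eq_pw_lip _ (fun a =>
    expect (mu a t) (fun x' => agent_kernel P (pi a t) (Gop W mu a t) x' x))).
  by move=> a Ia; rewrite gmfe_step.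
apply: pw_lip_sum => x'; apply: pw_lipM; first exact: IH.
apply: pw_lip_sum => u; apply: pw_lipM.
  apply: (lipschitz_except_finite_pw_lip (pi_lip t x' u)) => a Ia.
  exact: is_prob_le1 (gmfe_policy Ia x' tT').
apply: (@pw_lip_dom _ X (fun y a => Gop W mu a t y) _ Lp 1) => //.
- by move=> y; exact: Gop_pw_lip.
- by move=> a Ia; apply: is_prob_le1; apply: Pok; exact: Gop_bmeas.
- move=> a b Ia Ib.
  apply: le_trans (Plip x' u (Gop_bmeas Ia tT') (Gop_bmeas Ib tT')).
  by rewrite /l1 (bigD1 x)//= lerDl sumr_ge0.
Qed.

(** The constant is uniform in [a] because all sections [W a] share the same exceptional points;
    those of [mu] are appended. Summing over times and states removes the remaining dependence. *)
Lemma Gop_riemann : exists K : R, 0 <= K /\ forall N a t, (0 < N)%N -> unitI a ->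
  (t < T)%N ->
  \sum_x `|N%:R^-1 * (\sum_(j < N) W a (@grid R N j.+1) * mu (@grid R N j.+1) t x)
           - Gop W mu a t x| <= K / N%:R.
Proof.
have [|K KP] := @choice ('I_T * X)%type R (fun tx K => 0 <= K /\
    forall N a, (0 < N)%N -> unitI a ->
    `|N%:R^-1 * (\sum_(j < N) W a (@grid R N j.+1) * mu (@grid R N j.+1) tx.1 tx.2)
      - Gop W mu a tx.1 tx.2| <= K / N%:R).
  case=> t x /=; have tT := ltn_ord t.
  have [D' [L' [M [L'0 muL _]]]] := gmfe_pw_lip x tT.
  exists ((L + C * L') + 2 * C * (size (D ++ D'))%:R); split.
    by rewrite !(addr_ge0, mulr_ge0).
  move=> N a N0 Ia; rewrite distrC [leRHS]mulrC.
  apply: (riemann_sum N0 (f := fun b => W a b * mu b t x)).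
  - exact: Gop_integrand_measurable.
  - by rewrite addr_ge0// mulr_ge0.
  - move=> b b' Ib Ib' sep.
    have -> : W a b * mu b t x - W a b' * mu b' t x =
      (W a b - W a b') * mu b t x + W a b' * (mu b t x - mu b' t x) by ring.
    apply: le_trans (ler_normD _ _) _; rewrite !normrM mulrDl -mulrA lerD//.
      rewrite -[leRHS]mulr1 ler_pM//; last exact: is_prob_le1 (gmfe_prob Ib tT).
      apply: (Wlip2 Wg Wlip) => // d dD; apply: sep.
      by rewrite mem_cat dD.
    rewrite ler_pM// ?WC//; apply: muL => // d dD; apply: sep.
    by rewrite mem_cat dD orbT.
  - by move=> b Ib; exact: Gop_integrand_le.
have K0 t : 0 <= \sum_x K (t, x) by apply: sumr_ge0 => x _; exact: (KP (t, x)).1.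
exists (\sum_t \sum_x K (t, x)); split; first exact: sumr_ge0.
move=> N a t N0 Ia tT.
apply: (@le_trans _ _ (\sum_x K (Ordinal tT, x) / N%:R)).
  by apply: ler_sum => x _; exact: (KP (Ordinal tT, x)).2.
rewrite -big_distrl ler_wpM2r ?invr_ge0//= (bigD1 (Ordinal tT))//= lerDl.
exact: sumr_ge0.
Qed.

End MeanFieldRegularity.

(** * Approximate equilibrium *)

Section Assembly.
Variables (R : realType) (X U : finType) (T : nat).
Variables (mu0 : X -> R) (P : X -> U -> (X -> R) -> X -> R).
Variables (r : X -> U -> (X -> R) -> R) (W : R -> R -> R).
Variables (pi : R -> nat -> X -> U -> R) (mu : R -> nat -> X -> R).
Hypotheses (mu0P : is_prob mu0) (Pok : kernel_ok P) (Wg : is_graphon W).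
Hypothesis gmfe : is_GMFE T W P r mu0 pi mu.
Variables (C Lp Lr : R).
Hypotheses (C0 : 0 <= C) (Lp0 : 0 <= Lp) (Lr0 : 0 <= Lr).
Hypothesis WC : forall x y, unitI x -> unitI y -> `|W x y| <= C.
Hypothesis Plip : forall x u nu nu', is_bmeas nu -> is_bmeas nu' ->
  l1 (fun y => P x u nu y - P x u nu' y) <= Lp * l1 (fun y => nu y - nu' y).
Hypothesis rlip : forall x u nu nu', is_bmeas nu -> is_bmeas nu' ->
  `|r x u nu - r x u nu'| <= Lr * l1 (fun y => nu y - nu' y).

(** The reward at the zero measure plus its Lipschitz increment up to a field with entries at most
    [C]; the added 1 makes it positive, as [payoff_error] divides by it. *)
Definition reward_bound : R :=
  1 + \sum_x \sum_u `|r x u (fun=> 0)| + Lr * (#|X|%:R * C).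

Lemma reward_bound_gt0 : 0 < reward_bound.
Proof.
rewrite /reward_bound -addrA ltr_pwDl// addr_ge0 ?mulr_ge0//.
by do 2!apply: sumr_ge0 => ? _.
Qed.

Lemma reward_le a t x u : unitI a -> (t < T)%N ->
  `|r x u (Gop W mu a t)| <= reward_bound.
Proof.
move=> Ia tT; have z0 : @is_bmeas R X (fun=> 0) by move=> y.
have h1 : `|r x u (fun=> 0)| <= \sum_x \sum_u `|r x u (fun=> 0)|.
  rewrite (bigD1 x)//= (bigD1 u)//= -addrA lerDl addr_ge0//; first exact: sumr_ge0.
  by do 2!apply: sumr_ge0 => ? _.
have h2 : `|r x u (Gop W mu a t) - r x u (fun=> 0)| <= Lr * (#|X|%:R * C).
  apply: le_trans (rlip x u (Gop_bmeas Wg gmfe Ia tT) z0) _.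
  rewrite ler_wpM2l// mulr_natl -sumr_const; apply: ler_sum => y _.
  by rewrite subr0 (Gop_le Wg gmfe WC).
rewrite -[r x u _](subrK (r x u (fun=> 0))); apply: le_trans (ler_normD _ _) _.
by apply: le_trans (lerD h2 h1) _; rewrite /reward_bound; lra.
Qed.

Definition value_const : R :=
  let c := \sum_(t < T) mf_const X Lp (C + 1) t in
  T%:R * (Lr * c + reward_bound * (T%:R * (Lp * c))).

Lemma mf_const_ge0 t : 0 <= mf_const X Lp (C + 1) t.
Proof. by rewrite addr_ge0// mulr_ge0// lln_const_ge0// addr_ge0. Qed.

Lemma value_const_ge0 : 0 <= value_const.
Proof.
have c0 : 0 <= \sum_(t < T) mf_const X Lp (C + 1) t.
  by apply: sumr_ge0 => t _; exact: mf_const_ge0.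
have M0 := ltW reward_bound_gt0.
by rewrite mulr_ge0// addr_ge0// ?mulr_ge0// mulr_ge0.
Qed.

(** * Payoffs and best responses on a fixed graph *)

Section OneGraph.
Variables (N : nat) (E : 'I_N -> 'I_N -> bool) (rho eta : R).
Hypotheses (N0 : (0 < N)%N) (rho0 : 0 < rho) (eta0 : 0 < eta).
Hypothesis inv_le : (N%:R * rho)^-1 <= eta.
Hypothesis var_le : (N%:R * rho)^-1 * (C + 1) <= eta ^+ 2.

Local Notation node j := (@grid R N j.+1).

Definition node_mf (j : 'I_N) (t : nat) : X -> R := mu (node j) t.
Definition node_field (j : 'I_N) (t : nat) : X -> R := Gop W mu (node j) t.
Definition bad_nodes : nat -> {set 'I_N} := bad E rho C T node_field node_mf eta.

Lemma node_unitI (j : 'I_N) : unitI (node j).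
Proof. exact: grid_unitI. Qed.

Lemma bad_nodes_mono s t : (s <= t)%N -> bad_nodes s \subset bad_nodes t.
Proof.
elim: t => [|t IH]; first by rewrite leqn0 => /eqP ->.
rewrite leq_eqVlt => /predU1P[-> //|]; rewrite ltnS => /IH.
by move/fintype.subset_trans; apply; exact: bad_mono.
Qed.

(** Formulated for any profile that agrees with [GammaN N pi] off [i], so that the equilibrium
    profile and all deviations of [i] share the same exceptional set and constant. *)
Lemma value_near (pis : 'I_N -> nat -> X -> U -> R) (i : 'I_N) :
  (forall j, is_policy T (pis j)) ->
  (forall j, j != i -> pis j = GammaN N pi j) -> i \notin bad_nodes T ->
  `|JN E rho T P r mu0 pis i - Jmf T W P r mu0 mu (node i) (pis i)|
  <= value_const * eta.
Proof.
move=> pisP pisE iB.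
pose c := \sum_(t < T) mf_const X Lp (C + 1) t.
have ui := node_unitI.
have gerr t : (t < T)%N -> expect (fin_law E rho P mu0 pis t)
    (fun s => l1 (fun y => Gfin E rho s i y - node_field i t y)) <= c * eta.
  move=> tT; have iBt : i \notin bad_nodes t.
    by apply: contra iB; apply/fintype.subsetP/bad_nodes_mono; exact: ltnW.
  have K0 : 0 <= C + 1 by exact: addr_ge0.
  apply: (@le_trans _ _ (mf_const X Lp (C + 1) t * eta)); last first.
    rewrite ler_wpM2r ?(ltW eta0)// /c (bigD1 (Ordinal tT))//= lerDl.
    by apply: sumr_ge0 => s _; exact: mf_const_ge0.
  apply: (mean_field_error Pok mu0P rho0 (pib := GammaN N pi) (i := i)
    (m := node_mf) (B := bad_nodes) _ pisP pisE _ _ _ Lp0 K0 eta0 Plip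
    _ _ _ _ inv_le var_le tT iBt).
  - by move=> j; exact: (gmfe_policy gmfe (ui j)).
  - by move=> j s sT; exact: (Gop_bmeas Wg gmfe (ui j) sT).
  - by move=> j x T0; exact: (gmfe_init gmfe x (ui j) T0).
  - by move=> j s y sT; exact: (gmfe_step gmfe y (ui j) sT).
  - by move=> s; exact: bad_mono.
  - by move=> s k; exact: bad_deg.
  - by move=> s k; exact: bad_nbr.
  - by move=> s k sT; exact: bad_mf.
apply: le_trans (payoff_error Pok mu0P rho0 pisP
  (fun t tT => Gop_bmeas Wg gmfe (ui i) tT) Lp0 Lr0 reward_bound_gt0 Plip rlip
  (fun t x u tT => reward_le x u (ui i) tT) gerr) _.
by rewrite /value_const -/c; apply: eq_ler; ring.
Qed.

(** The payoffs with and without the deviation are each replaced by their mean field values, where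
    the equilibrium policy is optimal; hence the factor 2. *)
Lemma best_response (i : 'I_N) pi' : i \notin bad_nodes T -> is_policy T pi' ->
  JN E rho T P r mu0 (deviate (GammaN N pi) i pi') i
    - 2 * (value_const * eta) <= JN E rho T P r mu0 (GammaN N pi) i.
Proof.
move=> iB pi'P; have ui := node_unitI.
have GP j : is_policy T (GammaN N pi j) by exact: (gmfe_policy gmfe (ui j)).
have dP j : is_policy T (deviate (GammaN N pi) i pi' j).
  by rewrite /deviate; case: ifP.
have dE j : j != i -> deviate (GammaN N pi) i pi' j = GammaN N pi j.
  by rewrite /deviate => /negbTE ->.
have := value_near GP (fun j _ => erefl) iB.
have := value_near dP dE iB.
rewrite {2}/deviate eqxx !ler_norml => /andP[_ h1] /andP[h2 _].
have h3 : Jmf T W P r mu0 mu (node i) pi' <=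
    Jmf T W P r mu0 mu (node i) (GammaN N pi i).
  by case: gmfe => _ _ _; apply.
by move: h1 h2 h3; lra.
Qed.

End OneGraph.

End Assembly.

Theorem theorem3 (R : realType) (X U : finType) (T : nat)
  (mu0 : X -> R) (P : X -> U -> (X -> R) -> X -> R)
  (r : X -> U -> (X -> R) -> R) (W : R -> R -> R)
  (E : forall N : nat, 'I_N -> 'I_N -> bool) (rho : nat -> R) :
  is_prob mu0 -> kernel_ok P -> is_graphon W ->
  (forall N (i j : 'I_N), E N i j = E N j i) ->
  (forall N, 0 < rho N) ->
  (exists (c1 c2 : R) (N0 : nat), 0 < c1 /\ 0 < c2 /\
     forall N, (N0 <= N)%N ->
       c1 * ((nedges (E N))%:R / (N%:R ^+ 2)) <= rho N /\
       rho N <= c2 * ((nedges (E N))%:R / (N%:R ^+ 2))) ->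
  assumption_A1 W E rho ->
  assumption_A2 W P r ->
  forall (pi : R -> nat -> X -> U -> R) (mu : R -> nat -> X -> R),
    is_GMFE T W P r mu0 pi mu ->
    (forall t x u, lipschitz_except_finite (fun a => pi a t x u)) ->
    forall eps p : R, 0 < eps -> 0 < p ->
      exists N' : nat, forall N : nat, (N' < N)%N ->
        is_MNE (E N) (rho N) T P r mu0 eps p (GammaN N pi).
Proof.
move=> mu0P Pok Wg _ rho0 [c1 [c2 [M0 [_ [c20 rhoE]]]]] A1.
move=> [[Lr rL] [Lp pL] Wreg] pi mu gmfe pi_lip eps p eps0 p0.
have rlip x u nu nu' : is_bmeas nu -> is_bmeas nu' ->
    `|r x u nu - r x u nu'| <= `|Lr| * l1 (fun y => nu y - nu' y).
  move=> nu0 nu'0; apply: le_trans (rL x x u u _ _ nu0 nu'0) _.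
  by rewrite /discr !eqxx !add0r ler_wpM2r ?ler_norm// sumr_ge0.
have Plip x u nu nu' : is_bmeas nu -> is_bmeas nu' ->
    l1 (fun y => P x u nu y - P x u nu' y) <= `|Lp| * l1 (fun y => nu y - nu' y).
  move=> nu0 nu'0; apply: le_trans (pL x x u u _ _ nu0 nu'0) _.
  by rewrite /discr !eqxx !add0r ler_wpM2r ?ler_norm// sumr_ge0.
have [D [L [C [L0 C0 Wlip WC]]]] := graphon_regular Wreg.
have [K [K0 riem]] :=
  Gop_riemann Pok Wg gmfe L0 C0 (normr_ge0 Lp) Wlip WC Plip pi_lip.
have [V [V0 VE]] : exists V, 0 <= V /\ V = value_const T r C `|Lp| `|Lr|.
  exists (value_const T r C `|Lp| `|Lr|); split=> //.
  exact: (value_const_ge0 T r C0 (normr_ge0 Lp) (normr_ge0 Lr)).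
(* Makes the loss [2 * (V * eta)] of [best_response] at most [eps]; the added 1 keeps the
   denominator positive. *)
pose eta := eps / (2 * V + 1).
have eta0 : 0 < eta by rewrite divr_gt0// ltr_wpDl// mulr_ge0.
have etaV : 2 * (V * eta) <= eps.
  rewrite mulrA /eta mulrA ler_pdivrMr ?ltr_wpDl ?mulr_ge0// [leRHS]mulrC ler_pM2r//.
  by rewrite lerDl.
(* An upper bound on [1/d] that yields both [inv_le] and [var_le]. *)
pose kappa := Num.min eta (eta ^+ 2 / (C + 1)).
have C1 : 0 < C + 1 by rewrite ltr_wpDl.
have kappa0 : 0 < kappa by rewrite lt_min eta0 divr_gt0// exprn_gt0.
(* Once [delta <= e] and [c2 * delta <= 2^-1], [mean_degree_lower] reads [1 <= 1/2 + kappa * d / 2],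
   that is [1/d <= kappa]. *)
pose e := kappa / (4 * (c2 * C + 1)).
have cC0 : 0 <= c2 * C by rewrite mulr_ge0// ltW.
have e0 : 0 < e by rewrite divr_gt0// mulr_gt0// ltr_wpDl.
have ecC : 4 * (c2 * C) * e <= kappa.
  rewrite /e [leLHS]mulrA ler_pdivrMr ?mulr_gt0 ?ltr_wpDl// [leRHS]mulrC ler_pM2r//.
  by rewrite ler_pM2l// lerDl.
pose A := bad_const C X T eta T.
have A0 : 0 <= A.
  rewrite /A; elim: {2}T => [|t IH] /=; last first.
    by rewrite addr_ge0// divr_ge0 ?(ltW eta0)// addr_ge0// mulr_ge0.
  by rewrite addr_ge0// !mulr_ge0// invr_ge0 ltW.
(* The first two bounds serve the degree estimate, the third makes the exceptional set no larger
   than [p * N]. *)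
pose delta := Num.min e (Num.min (2 * c2)^-1 (p / (A + 1))).
have A1p : 0 < A + 1 by rewrite ltr_wpDl.
have delta0 : 0 < delta.
  by rewrite !lt_min e0 invr_gt0 mulr_gt0// divr_gt0.
have delta_e : delta <= e by rewrite ge_min lexx.
have delta_c2 : c2 * delta <= 2^-1.
  have : delta <= (2 * c2)^-1 by rewrite !ge_min lexx orbT.
  by rewrite invfM [X in _ <= X -> _]mulrC ler_pdivlMl.
have delta_A : delta * A <= p.
  have : delta <= p / (A + 1) by rewrite !ge_min lexx !orbT.
  rewrite ler_pdivlMr// mulrDr mulr1; apply: le_trans.
  by rewrite lerDl ltW.
have [n1 gap] := graphon_gap_small Wg L0 C0 Wlip WC rho0 A1 delta0.
pose n2 := Num.truncn (C ^+ 2 / e ^+ 2).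
pose n3 := Num.truncn (K / (eta / 2)).
(* In order: smallness of the graphon gap, validity of the density bounds, [C ^+ 2 / N <= e ^+ 2],
   and the Riemann error below [eta / 2]. *)
exists (maxn (maxn n1 M0) (maxn n2 n3)) => N.
rewrite !gtn_max => /andP[/andP[n1N M0N] /andP[n2N n3N]].
have N0 : (0 < N)%N by exact: leq_ltn_trans n1N.
have NR0 : 0 < N%:R :> R by rewrite ltr0n.
have truncN (x : R) : (Num.truncn x < N)%N -> x <= N%:R.
  move=> xN; apply/ltW/(lt_le_trans (truncnS_gt _)); by rewrite ler_nat.
have Ce : C ^+ 2 / N%:R <= e ^+ 2.
  by rewrite ler_pdivrMr// [leRHS]mulrC -ler_pdivrMr ?exprn_gt0// truncN.
have KN : K / N%:R <= eta / 2.
  have eta20 : 0 < eta / 2 by rewrite divr_gt0.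
  by rewrite ler_pdivrMr// [leRHS]mulrC -(ler_pdivrMr _ _ eta20) truncN.
pose w (k j : 'I_N) := W (@grid R N k.+1) (@grid R N j.+1).
have gridI (j : 'I_N) : unitI (@grid R N j.+1) by exact: grid_unitI.
have wC k j : `|w k j| <= C by exact: WC.
have d0 : 0 < N%:R * rho N by rewrite mulr_gt0.
have d_inv : (N%:R * rho N)^-1 <= kappa.
  have [_ rho_le] := rhoE N (ltnW M0N).
  have := mean_degree_lower N0 (rho0 N) C0 wC (gap N n1N) c20 e0 rho_le Ce.
  move=> H; rewrite -[leLHS]mul1r ler_pdivrMr//.
  have : c2 * (C * (N%:R * rho N) * (delta + e)) <= kappa * (N%:R * rho N) / 2.
    have -> : c2 * (C * (N%:R * rho N) * (delta + e)) =
      (c2 * C) * (delta + e) * (N%:R * rho N) by ring.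
    rewrite [leRHS]mulrAC ler_pM2r// ler_pdivlMr//; apply: le_trans ecC.
    by move: (ler_wpM2l cC0 delta_e); lra.
  by move: H delta_c2; lra.
have inv_le : (N%:R * rho N)^-1 <= eta.
  by apply: le_trans d_inv _; rewrite ge_min lexx.
have var_le : (N%:R * rho N)^-1 * (C + 1) <= eta ^+ 2.
  by rewrite -ler_pdivlMr//; apply: le_trans d_inv _; rewrite ge_min lexx orbT.
pose B := bad_nodes T W mu C (E N) (rho N) eta T.
exists (~: B); split; last first.
  move=> i; rewrite finset.in_setC => iB pi' pi'P.
  apply: le_trans (best_response mu0P Pok Wg gmfe C0 (normr_ge0 Lp)
    (normr_ge0 Lr) WC Plip rlip N0 (rho0 N) eta0 inv_le var_le iB pi'P).
  by rewrite -VE lerD2l lerN2.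
have cardB : #|B|%:R <= p * N%:R.
  have m01 (j : 'I_N) t x : (t < T)%N -> 0 <= mu (@grid R N j.+1) t x <= 1.
    move=> tT; have muP := gmfe_prob gmfe (gridI j) tT.
    by rewrite muP.1 (le_trans (ler_norm _) (is_prob_le1 x muP)).
  have rie (k : 'I_N) t : (t < T)%N -> \sum_x `|N%:R^-1 *
      (\sum_j w k j * mu (@grid R N j.+1) t x) - Gop W mu (@grid R N k.+1) t x|
      <= eta / 2.
    by move=> tT; apply: le_trans (riem N _ t N0 (gridI k) tT) KN.
  apply: le_trans (card_bad N0 (rho0 N) C0 wC (gap N n1N) eta0 m01 rie T) _.
  by rewrite -mulrA mulrC ler_pM2r.
(* The floor is at most [(1 - p) * N], which is at most [N] minus the size of [B]. *)
rewrite -(ler_int R); apply: le_trans (floor_le _) _.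
rewrite -pmulrn; have := cardsC B; rewrite card_ord => /(congr1 (fun n => n%:R : R)).
by rewrite natrD; move: cardB; lra.
Qed.
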